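(* Let $r\geqslant3$, let $\mathcal A_2$ be the class of $r$th order linear ODEs in the second Arnold form $x^{(r)}+a_{r-1}(t)x^{(r-1)}+\dots+a_2(t)x^{(2)}=b(t)$ with arbitrary smooth functions $a_{r-1},\dots,a_2,b$ of $t$, and let $\widehat{\mathcal A}_2$ be its subclass of homogeneous equations ($b=0$). The classes $\mathcal A_2$ and $\widehat{\mathcal A}_2$ are not semi-normalized.
   Context: The underlying field $\mathbb F$ is $\mathbb R$ or $\mathbb C$; all variables, functions and constants are real or complex, respectively. $x=x(t)$ is the unknown function, $x^{(k)}=d^kx/dt^k$. Everything is local: functions and transformations are smooth and considered on suitable open domains. A point transformation is a transformation $\tilde t=T(t,x)$, $\tilde x=X(t,x)$ with nonvanishing Jacobian $\partial(T,X)/\partial(t,x)$; it acts on ODEs via prolongation to derivatives. The arbitrary elements of a class of ODEs are the functions (coefficients, right-hand side) parameterizing it. An admissible transformation of a class is a triple $(\mathcal E,\tilde{\mathcal E},\mathcal T)$, where $\mathcal E$ and $\tilde{\mathcal E}$ are equations of the class and $\mathcal T$ is a point transformation mapping $\mathcal E$ to $\tilde{\mathcal E}$. The (usual) equivalence (pseudo)group of the class consists of the point transformations in the joint space of $t$, $x$, the derivatives of $x$ and the arbitrary elements that are consistent with the contact structure (the components for derivatives are obtained by prolongation), are projectable to the $(t,x)$-space (the components for $t$ and $x$ depend only on $(t,x)$), and map every equation of the class to an equation of the class. A class is semi-normalized if for every admissible transformation $(\mathcal E,\tilde{\mathcal E},\mathcal T)$, $\mathcal T$ is the composition of a point symmetry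 transformation of $\mathcal E$ followed by the projection of an equivalence transformation to the $(t,x)$-space. *)

(* Defs.v *)
From HB Require Import structures.
From mathcomp Require Import all_boot all_order all_algebra.
From mathcomp Require Import complex.
From mathcomp Require Import boolp classical_sets reals topology normedtype derive.

Set Implicit Arguments.
Unset Strict Implicit.
Unset Printing Implicit Defensive.

Import Order.TTheory GRing.Theory Num.Theory.
Import numFieldNormedType.Exports.

Local Open Scope classical_set_scope.
Local Open Scope ring_scope.

(* Everything is stated over a numFieldType K, to be
   instantiated with the reals (R : realType) and with the complex numbers R[i];
   over R[i] the derivatives below are complex derivatives, so that smooth means
   holomorphic. *)

(* f is k times continuously differentiable on the open set U. *)
Fixpoint Ck (K : numFieldType) (V W : normedModType K) (k : nat)
    (U : set V) (f : V -> W) : Prop :=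
  match k with
  | 0%N => forall p, U p -> {for p, continuous f}
  | k'.+1 => (forall p, U p -> differentiable f p) /\
             (forall v, Ck k' U (fun p => 'D_v f p))
  end.

Definition smooth (K : numFieldType) (V W : normedModType K)
    (U : set V) (f : V -> W) : Prop :=
  forall k, Ck k U f.

(* Local transformation of K^n on the open domain U; f is irrelevant off U. *)
Definition point_transformation (K : numFieldType) (n : nat)
    (U : set 'rV[K]_n) (f : 'rV[K]_n -> 'rV[K]_n) : Prop :=
  [/\ open U, U !=set0, smooth U f &
      forall p, U p -> \det ('J f p) != 0].

(* Coordinates: (t, x) : 'rV_2;  (t, x, x', ..., x^(r)) : 'rV_(2 + r), where
   x^(k) has index k.+1;  (t, x, x', ..., x^(r), theta) : 'rV_(2 + r + m), where
   theta is the m-tuple of values of the arbitrary elements. *)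

Definition base (K : numFieldType) (r : nat) (j : 'rV[K]_(2 + r)) : 'rV[K]_2 :=
  lsubmx j.

Definition time (K : numFieldType) (r : nat) (j : 'rV[K]_(2 + r)) : K :=
  base j 0 0.

Definition xder (K : numFieldType) (r k : nat) (j : 'rV[K]_(2 + r)) : K :=
  j 0 (inord k.+1 : 'I_r.+2).

Definition jet_of (K : numFieldType) (r m : nat) (z : 'rV[K]_(2 + r + m)) :
  'rV[K]_(2 + r) := lsubmx z.

Definition elements_of (K : numFieldType) (r m : nat)
  (z : 'rV[K]_(2 + r + m)) : 'rV[K]_m := rsubmx z.

(* The vector (1, x', ..., x^(r), 0). *)
Definition contact_vector (K : numFieldType) (r : nat) (j : 'rV[K]_(2 + r)) :
    'rV[K]_(2 + r) :=
  \row_(i < 2 + r)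
    if (i : nat) == 0%N then 1 else if (i <= r)%N then xder i j else 0.

(* D_t = d/dt + x' d/dx + x'' d/dx' + ..., for functions of derivatives of x of
   order less than r. *)
Definition total_derivative (K : numFieldType) (r : nat)
    (F : 'rV[K]_(2 + r) -> K) (j : 'rV[K]_(2 + r)) : K :=
  'D_(contact_vector j) F j.

Definition Tcomp (K : numFieldType) (r : nat) (phi : 'rV[K]_2 -> 'rV[K]_2)
  (j : 'rV[K]_(2 + r)) : K := phi (base j) 0 0.

Definition Xcomp (K : numFieldType) (r : nat) (phi : 'rV[K]_2 -> 'rV[K]_2)
  (j : 'rV[K]_(2 + r)) : K := phi (base j) 0 1.

(* Prolongation to derivatives of order at most r:
   X^(0) = X,  X^(k+1) = D_t X^(k) / D_t T. *)
Definition prolong (K : numFieldType) (r : nat) (phi : 'rV[K]_2 -> 'rV[K]_2)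
    (j : 'rV[K]_(2 + r)) : 'rV[K]_(2 + r) :=
  \row_(i < 2 + r)
    if (i : nat) == 0%N then Tcomp phi j
    else iter i.-1
           (fun F j' => total_derivative F j' /
                        total_derivative (Tcomp phi) j')
           (Xcomp phi) j.

Definition prolong_dom (K : numFieldType) (r : nat)
    (phi : 'rV[K]_2 -> 'rV[K]_2) : set 'rV[K]_(2 + r) :=
  [set j | total_derivative (Tcomp phi) j != 0].

(* L : ode_class K r m stands for the class of equations
   L(theta(t), (t, x, ..., x^(r))) = 0, where the tuple theta of arbitrary
   elements runs through all smooth functions of t on open sets. *)
Definition ode_class (K : numFieldType) (r m : nat) : Type :=
  'rV[K]_m -> 'rV[K]_(2 + r) -> K.

Definition arbitrary_elements (K : numFieldType) (m : nat)
    (I : set K) (theta : K -> 'rV[K]_m) : Prop :=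
  open I /\ smooth I theta.

Definition strip (K : numFieldType) (I : set K) : set 'rV[K]_2 :=
  [set p | I (p 0 0)].

(* Over D, the prolongation of phi identifies the manifold in the jet space given
   by the equation theta with the one given by the equation theta'. *)
Definition maps_equation (K : numFieldType) (r m : nat) (L : ode_class K r m)
    (D : set 'rV[K]_2) (phi : 'rV[K]_2 -> 'rV[K]_2)
    (theta theta' : K -> 'rV[K]_m) : Prop :=
  forall j : 'rV[K]_(2 + r), D (base j) -> prolong_dom phi j ->
    L (theta (time j)) j = 0 <->
    L (theta' (time (prolong phi j))) (prolong phi j) = 0.

Definition admissible_transformation (K : numFieldType) (r m : nat)
    (L : ode_class K r m)
    (I : set K) (theta : K -> 'rV[K]_m)
    (I' : set K) (theta' : K -> 'rV[K]_m)
    (U : set 'rV[K]_2) (phi : 'rV[K]_2 -> 'rV[K]_2) : Prop :=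
  [/\ arbitrary_elements I theta, arbitrary_elements I' theta',
      point_transformation U phi,
      U `<=` strip I /\ phi @` U `<=` strip I' &
      maps_equation L U phi theta theta'].

Definition point_symmetry (K : numFieldType) (r m : nat) (L : ode_class K r m)
    (I : set K) (theta : K -> 'rV[K]_m)
    (U : set 'rV[K]_2) (phi : 'rV[K]_2 -> 'rV[K]_2) : Prop :=
  admissible_transformation L I theta I theta U phi.

Definition joint_proj (K : numFieldType) (r m : nat)
    (Om : set 'rV[K]_(2 + r + m)) : set 'rV[K]_2 :=
  (fun z => base (jet_of z)) @` Om.

(* The points of Om lying over the graph of theta. *)
Definition over_graph (K : numFieldType) (r m : nat)
    (Om : set 'rV[K]_(2 + r + m)) (I : set K) (theta : K -> 'rV[K]_m) :
    set 'rV[K]_(2 + r + m) :=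
  [set z | [/\ Om z, I (time (jet_of z)) &
              elements_of z = theta (time (jet_of z))]].

(* Phi, on the open subset Om of the joint space, is an equivalence
   transformation with projection phi to the (t, x)-space.  Each equation theta
   of the class is mapped by phi to an equation theta', at all jets over the
   (t, x)-points at which Phi acts on theta, and the components of Phi for the
   arbitrary elements send theta to theta'.  (Testing only the jets in Om would
   be vacuous for an Om missing the equations.) *)
Definition equivalence_transformation (K : numFieldType) (r m : nat)
    (L : ode_class K r m)
    (Om : set 'rV[K]_(2 + r + m))
    (Phi : 'rV[K]_(2 + r + m) -> 'rV[K]_(2 + r + m))
    (phi : 'rV[K]_2 -> 'rV[K]_2) : Prop :=
  [/\ point_transformation Om Phi,
      point_transformation (joint_proj Om) phi,
      forall z, Om z ->
        prolong_dom phi (jet_of z) /\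
        jet_of (Phi z) = prolong phi (jet_of z) &
      forall (I : set K) (theta : K -> 'rV[K]_m), arbitrary_elements I theta ->
        exists (I' : set K) (theta' : K -> 'rV[K]_m),
          [/\ arbitrary_elements I' theta',
              forall z, over_graph Om I theta z ->
                I' (time (jet_of (Phi z))) /\
                elements_of (Phi z) = theta' (time (jet_of (Phi z))) &
              maps_equation L (joint_proj (over_graph Om I theta)) phi
                theta theta']].

(* Transformations are local, so the decomposition of an admissible
   transformation is required only after shrinking its domain U to some nonempty
   open V.  This makes semi-normalization as weak as possible. *)
Definition semi_normalized (K : numFieldType) (r m : nat)
    (L : ode_class K r m) : Prop :=
  forall (I : set K) (theta : K -> 'rV[K]_m)
         (I' : set K) (theta' : K -> 'rV[K]_m)
         (U : set 'rV[K]_2) (T : 'rV[K]_2 -> 'rV[K]_2),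
    admissible_transformation L I theta I' theta' U T ->
    exists (V : set 'rV[K]_2) (sigma : 'rV[K]_2 -> 'rV[K]_2)
           (Om : set 'rV[K]_(2 + r + m))
           (Phi : 'rV[K]_(2 + r + m) -> 'rV[K]_(2 + r + m))
           (phi : 'rV[K]_2 -> 'rV[K]_2),
      [/\ V `<=` U,
          point_symmetry L I theta V sigma,
          equivalence_transformation L Om Phi phi,
          sigma @` V `<=` joint_proj Om &
          forall p, V p -> T p = phi (sigma p)].

(* x^(r) + a_(r-1) x^(r-1) + ... + a_2 x^(2), where a 0 i is a_(i+2). *)
Definition arnold2_lhs (K : numFieldType) (r : nat)
    (a : 'rV[K]_(r - 2)) (j : 'rV[K]_(2 + r)) : K :=
  xder r j + \sum_(i < r - 2) a 0 i * xder i.+2 j.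

(* The tuple of arbitrary elements is (a_2, ..., a_(r-1), b). *)
Definition arnold2 (K : numFieldType) (r : nat) : ode_class K r (r - 2 + 1) :=
  fun theta j => arnold2_lhs (lsubmx theta) j - rsubmx theta 0 0.

(* The tuple of arbitrary elements is (a_2, ..., a_(r-1)). *)
Definition arnold2_hom (K : numFieldType) (r : nat) : ode_class K r (r - 2) :=
  fun theta j => arnold2_lhs theta j.

(* Main.v *)
(* The map (t, x) |-> (t^2, x) sends x^(r) = 0 to an equation of both classes, since
   x^(r) is a combination of the d^k x / ds^k, s = t^2, with r / 2 <= k <= r, and
   r / 2 > 1.  Suppose that it equals phi o sigma with sigma = (S, Y) a symmetry of
   x^(r) = 0 and phi = (P, Q) the projection of an equivalence transformation.

   P_x = 0: otherwise some jet satisfying the source equation has D_t P = 0 and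
   D_t^2 P <> 0 (x'' is free because r >= 3); X^(k) has a pole of exact order 2k - 1
   in D_t P there, so the leading term of the target equation cannot be cancelled.

   Subtracting the images of two source equations that differ only in the
   coefficient of x'' shows that, on jets with x'' = 0, the prolongation X^(2)
   depends on P only.  Hence phi maps lines to parabolas with a common acceleration:
   k := Q_x / P_t depends on t alone, k'' = 0 and P'' k = - 2 P' k'.

   From P(S) = t^2 and Q(S, Y) = x, the map sigma is fibre-preserving and affine in
   x, and the coefficient of x^(r-1) in its prolongation gives
   2 (Y_x)' S' = (r - 1) Y_x S''.  Together these relations force 3 r = 7. *)
Require Import Defs.
From HB Require Import structures.
From mathcomp Require Import all_boot all_order all_algebra.
From mathcomp Require Import complex ring zify.
From mathcomp Require Import boolp classical_sets functions reals topology.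
From mathcomp Require Import normedtype landau derive.

Set Implicit Arguments.
Unset Strict Implicit.
Unset Printing Implicit Defensive.

Import Order.TTheory GRing.Theory Num.Theory.
Import numFieldNormedType.Exports.

Local Open Scope classical_set_scope.
Local Open Scope ring_scope.


(** * Smooth functions over a numeric field *)

(** The obstruction rests on one feature of an equivalence transformation: its domain is open in the
    arbitrary elements too. So a single [phi] must transform two equations with constant arbitrary
    elements that differ slightly in the coefficient of x''. Domains are shrunk to balls, where a
    vanishing x-derivative means independence of x. The relation 3 r = 7 comes from comparing powers
    of t. P'' k = - 2 P' k' makes k^2 P' constant, and the x-derivative k(S) P'(S) Y_x = 1 of Q(S,
    Y) = x then makes Y_x proportional to k(S). The symmetry relation makes (Y_x)^2 proportional to
    (S')^(r-1), and P'(S) S' = 2t makes S' proportional to t k(S)^2. Hence S' is a multiple of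
    t^(-1/(r-2)) and k(S) of t^(-(r-1)/(2(r-2))). As k is affine, the derivative of k(S) is a
    multiple of S'; if k' is nonzero, the exponents agree only when (r-1) + 2(r-2) = 2, and k' = 0
    contradicts the nonzero exponent of k(S). The formal argument uses logarithmic derivatives at
    one point, so that no powers of t are formed. *)

Section Smooth.
Variables (K : numFieldType) (V : normedModType K).

Section Values.
Variable (W : normedModType K).
Implicit Types (U : set V) (f g : V -> W).

Lemma Ck_continuous k U f p : Ck k U f -> U p -> {for p, continuous f}.
Proof.
by case: k => [|k] /=; [exact|case=> + _ Up => /(_ p Up)/differentiable_continuous].
Qed.

Lemma CkW k U f : Ck k.+1 U f -> Ck k U f.
Proof.
elim: k f => [|k IH] f; first by move=> h p; exact: Ck_continuous h.
by case=> h1 h2; split => // v; exact: IH.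
Qed.

Lemma near_open U (P : V -> Prop) p : open U -> U p -> (forall q, U q -> P q) ->
  \forall q \near p, P q.
Proof. by move=> oU Up h; apply: filterS h _; exact: open_nbhs_nbhs. Qed.

(** The first-order expansion of [f] at [p] is one of [g] too, and uniqueness of the differential
    identifies ['d g p] with ['d f p]. *)
Lemma near_eq_differentiable f g p : (\forall q \near p, f q = g q) ->
  differentiable f p -> differentiable g p.
Proof.
move=> fg df; have fgp := nbhs_singleton fg.
have dfc : continuous ('d f p) by exact: diff_continuous.
have gE : g \o shift p = cst (g p) + 'd f p +o_ (0 : V) id.
  apply/eqaddoP => e e0.
  have /eqaddoP/(_ e e0) := diff_locally df.
  have fg0 : \forall h \near (0 : V), f (h + p) = g (h + p).
    by move: fg; rewrite (near_shift 0) /= subr0.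
  by apply: filterS2 fg0 => h /= fgh; rewrite /= !fctE /= fgp fgh.
have dgE := diff_unique dfc gE.
by apply/diff_locallyP; rewrite dgE.
Qed.

Lemma Ck_eq k U f g : open U -> (forall p, U p -> f p = g p) ->
  Ck k U f -> Ck k U g.
Proof.
move=> oU; elim: k f g => [|k IH] f g fg /=.
  move=> fc p Up; have fgp := near_open oU Up fg.
  by rewrite /prop_for /continuous_at -(fg p Up); apply: cvg_trans (fc p Up);
    exact: near_eq_cvg.
case=> fd fD; split=> [p Up|v].
  exact: near_eq_differentiable (near_open oU Up fg) (fd p Up).
by apply: IH (fD v) => p Up; apply: near_eq_derive; exact: near_open oU Up fg.
Qed.

Lemma Ck_subset k U U' f : U' `<=` U -> Ck k U f -> Ck k U' f.
Proof.
move=> sU; elim: k f => [|k IH] f /=; first by move=> fc p /sU; exact: fc.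
by case=> fd fD; split=> [p /sU|v]; [exact: fd|exact/IH/fD].
Qed.

Lemma Ck_cst k U (w : W) : Ck k U (cst w).
Proof.
elim: k w => [|k IH] w /=; first by move=> p _; exact: cvg_cst.
split=> [p _|v]; first exact: differentiable_cst.
by rewrite (_ : (fun p => _) = cst 0) //; apply/funext => p; rewrite derive_cst.
Qed.

Lemma CkD k U f g : open U -> Ck k U f -> Ck k U g -> Ck k U (fun p => f p + g p).
Proof.
move=> oU; elim: k f g => [|k IH] f g /=.
  by move=> fc gc p Up; apply: cvgD; [exact: fc|exact: gc].
case=> fd fD [gd gD]; split=> [p Up|v].
  by apply: differentiableD; [exact: fd|exact: gd].
apply: Ck_eq (IH _ _ (fD v) (gD v)) => // p Up.
by rewrite deriveD //; apply: diff_derivable; [exact: fd|exact: gd].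
Qed.

Lemma Ck_sum k U n (f : 'I_n -> V -> W) : open U ->
  (forall i, Ck k U (f i)) -> Ck k U (fun p => \sum_i f i p).
Proof.
move=> oU; elim: n f => [|n IH] f fC.
  rewrite (_ : (fun p => _) = cst 0); first exact: Ck_cst.
  by apply/funext => p; rewrite big_ord0.
rewrite (_ : (fun p => _) = (fun p =>
  \sum_(i < n) f (widen_ord (leqnSn n) i) p + f ord_max p)).
  by apply: CkD => //; apply: IH.
by apply/funext => p; rewrite big_ord_recr.
Qed.

End Values.

Lemma CkM k (U : set V) (f g : V -> K) : open U -> Ck k U f -> Ck k U g ->
  Ck k U (fun p => f p * g p).
Proof.
move=> oU; elim: k f g => [|k IH] f g.
  by move=> fc gc p Up; apply: cvgM; [exact: fc|exact: gc].
move=> fC gC; have [[fd fD] [gd gD]] := (fC, gC); split=> [p Up|v].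
  by apply: differentiableM; [exact: fd|exact: gd].
apply: (@Ck_eq _ _ _ (fun p => f p * 'D_v g p + g p * 'D_v f p)) => // [p Up|].
  by rewrite deriveM //; apply: diff_derivable; [exact: fd|exact: gd].
by apply: CkD => //; apply: IH; [exact: CkW|exact: gD|exact: CkW|exact: fD].
Qed.

Lemma CkV k (U : set V) (f : V -> K) : open U -> (forall p, U p -> f p != 0) ->
  Ck k U f -> Ck k U (fun p => (f p)^-1).
Proof.
move=> oU f0; elim: k => [|k IH].
  by move=> fc p Up; apply: cvgV; [exact: f0|exact: fc].
move=> fC; have [fd fD] := fC; split=> [p Up|v].
  by apply: differentiableV; [exact: fd|exact: f0].
have fV := IH (CkW fC).
apply: (@Ck_eq _ _ _ (fun p => -1 * ((f p)^-1 * (f p)^-1 * 'D_v f p))) => // [p Up|].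
  rewrite deriveV ?f0//; last by apply: diff_derivable; exact: fd.
  by rewrite scaleNr expr2 invfM mulN1r.
apply: CkM => //; first exact: (@Ck_cst K).
by apply: CkM => //; [exact: CkM|exact: fD].
Qed.

Lemma Ck_scalel k (W : normedModType K) (U : set V) (f : V -> K) (w : W) : open U ->
  Ck k U f -> Ck k U (fun p => f p *: w).
Proof.
move=> oU; elim: k f => [|k IH] f /=.
  by move=> fc p Up; apply: cvgZr_tmp; exact: fc.
case=> fd fD; split=> [p Up|v]; first by apply: differentiableZl; exact: fd.
apply: (Ck_eq oU) (IH _ (fD v)) => // p Up.
rewrite [RHS]deriveE; last by apply: differentiableZl; exact: fd.
rewrite diffZl; last exact: fd.
by rewrite deriveE //; exact: fd.
Qed.

Lemma derive_comp_linear (V' W : normedModType K) (L : {linear V -> V'}) (f : V' -> W)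
  p v :
  'D_v (fun q => f (L q)) p = 'D_(L v) f (L p).
Proof. by rewrite /derive /=; under [in LHS]eq_fun do rewrite linearP. Qed.

Lemma Ck_comp_linear k (V' W : normedModType K) (L : {linear V -> V'}) (U : set V')
    (f : V' -> W) : continuous L -> Ck k U f -> Ck k (L @^-1` U) (fun p => f (L p)).
Proof.
move=> cL; elim: k f => [|k IH] f /=.
  by move=> fc p Up; apply: continuous_comp; [exact: cL|exact: fc].
case=> fd fD; split=> [p Up|v].
  apply: (differentiable_comp (f := L)); last exact: fd.
  exact: linear_differentiable.
rewrite (_ : (fun p => _) = (fun p => 'D_(L v) f (L p))); first exact: (IH _ (fD (L v))).
by apply/funext => p; rewrite derive_comp_linear.
Qed.

End Smooth.

Section SmoothFunctions.
Variables (K : numFieldType) (V : normedModType K).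
Implicit Types (U : set V).

Lemma smooth_differentiable (W : normedModType K) U (f : V -> W) p :
  smooth U f -> U p -> differentiable f p.
Proof. by move=> /(_ 1%N)[fd _]; exact: fd. Qed.

Lemma smooth_derivable (W : normedModType K) U (f : V -> W) p v :
  smooth U f -> U p -> derivable f p v.
Proof. by move=> fs Up; exact/diff_derivable/smooth_differentiable/Up. Qed.

Lemma smooth_derive (W : normedModType K) U (f : V -> W) v :
  smooth U f -> smooth U (fun p => 'D_v f p).
Proof. by move=> fs k; have [_] := fs k.+1; exact. Qed.

Lemma smooth_eq (W : normedModType K) U (f g : V -> W) : open U ->
  (forall p, U p -> f p = g p) -> smooth U f -> smooth U g.
Proof. by move=> oU fg fs k; exact: Ck_eq fg (fs k). Qed.

Lemma smooth_subset (W : normedModType K) U U' (f : V -> W) :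
  U' `<=` U -> smooth U f -> smooth U' f.
Proof. by move=> sU fs k; exact: Ck_subset (fs k). Qed.

Lemma smooth_cst (W : normedModType K) U (w : W) : smooth U (cst w).
Proof. by move=> k; exact: Ck_cst. Qed.

Lemma smooth_id U : smooth U (fun p : V => p).
Proof.
move=> [|k]; first by move=> p _; exact: cvg_id.
split=> [p _|v]; first exact: (@linear_differentiable _ _ _ idfun p (fun q => cvg_id)).
rewrite (_ : (fun p => _) = cst v); first exact: Ck_cst.
by apply/funext => p; exact: derive_id.
Qed.

Lemma smoothD (W : normedModType K) U (f g : V -> W) : open U ->
  smooth U f -> smooth U g -> smooth U (fun p => f p + g p).
Proof. by move=> oU fs gs k; exact: CkD. Qed.

Lemma smooth_sum (W : normedModType K) U n (f : 'I_n -> V -> W) : open U ->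
  (forall i, smooth U (f i)) -> smooth U (fun p => \sum_i f i p).
Proof. by move=> oU fs k; apply: Ck_sum => // i; exact: fs. Qed.

Lemma smoothM U (f g : V -> K) : open U ->
  smooth U f -> smooth U g -> smooth U (fun p => f p * g p).
Proof. by move=> oU fs gs k; exact: CkM. Qed.

Lemma smoothV U (f : V -> K) : open U -> (forall p, U p -> f p != 0) ->
  smooth U f -> smooth U (fun p => (f p)^-1).
Proof. by move=> oU f0 fs k; exact: CkV. Qed.

Lemma smoothX U (f : V -> K) n : open U ->
  smooth U f -> smooth U (fun p => f p ^+ n).
Proof.
move=> oU fs; elim: n => [|n IH]; first exact: (smooth_cst (W := K)).
rewrite (_ : (fun p => _) = (fun p => f p * f p ^+ n)); first exact: smoothM.
by apply/funext => p; rewrite exprS.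
Qed.

Lemma smoothB U (f g : V -> K) : open U ->
  smooth U f -> smooth U g -> smooth U (fun p => f p - g p).
Proof.
move=> oU fs gs; rewrite (_ : (fun p => _) = (fun p => f p + -1 * g p)).
  by apply: smoothD => //; apply: smoothM => //; exact: (smooth_cst (W := K)).
by apply/funext => p; rewrite mulN1r.
Qed.

Lemma smooth_comp_linear (V' W : normedModType K) (L : {linear V -> V'})
    (U : set V') (f : V' -> W) : continuous L -> smooth U f ->
  smooth (L @^-1` U) (fun p => f (L p)).
Proof. by move=> cL fs k; exact: Ck_comp_linear. Qed.

End SmoothFunctions.

Section Coordinates.
Variables (K : numFieldType).

Definition coord_fun n (i : 'I_n) (u : 'rV[K]_n) : K := u 0 i.
Fact coord_fun_linear n (i : 'I_n) : linear (coord_fun i).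
Proof. by move=> a u v; rewrite /coord_fun !mxE. Qed.
HB.instance Definition _ n (i : 'I_n) :=
  GRing.isLinear.Build K 'rV[K]_n K *%R (coord_fun i) (coord_fun_linear i).

Lemma coord_fun_continuous n (i : 'I_n) : continuous (coord_fun i).
Proof. exact: coord_continuous. Qed.

Lemma derive_coord_fun n (i : 'I_n) p v : 'D_v (fun u : 'rV[K]_n => u 0 i) p = v 0 i.
Proof.
rewrite deriveE; last exact: differentiable_coord.
by have /= -> := diff_lin (f := coord_fun i) p (@coord_fun_continuous n i).
Qed.

Lemma derivable_coord_fun n (i : 'I_n) p v :
  derivable (fun u : 'rV[K]_n => u 0 i) p v.
Proof. by apply: diff_derivable; exact: differentiable_coord. Qed.

Lemma smooth_coord_fun n (i : 'I_n) U : open U -> smooth U (fun u : 'rV[K]_n => u 0 i).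
Proof.
move=> oU [|k]; first by move=> p _; exact: coord_continuous.
split=> [p _|v]; first exact: differentiable_coord.
by under eq_fun do rewrite derive_coord_fun; exact: Ck_cst.
Qed.

Variable V : normedModType K.

Lemma derive_comp_linear_left (W' W : normedModType K) (L : {linear W' -> W}) (f : V ->
  W') p v :
  continuous L -> differentiable f p ->
  'D_v (fun q => L (f q)) p = L ('D_v f p).
Proof.
move=> cL fd; have Ld := linear_differentiable (f := L) (f p) cL.
rewrite deriveE; last exact: (differentiable_comp fd).
rewrite (deriveE _ fd); have /= -> := diff_comp fd Ld.
by rewrite diff_lin.
Qed.

Lemma derive_coord n (i : 'I_n) (f : V -> 'rV[K]_n) p v : differentiable f p ->
  'D_v (fun q => f q 0 i) p = ('D_v f p) 0 i.
Proof.
move=> fd; exact: (derive_comp_linear_left v (L := coord_fun i) (@coord_fun_continuous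
  n i) fd).
Qed.

Lemma smooth_coord n (i : 'I_n) U (f : V -> 'rV[K]_n) : open U -> smooth U f ->
  smooth U (fun p => f p 0 i).
Proof.
move=> oU fs k; elim: k f fs => [|k IH] f fs.
  move=> p Up; apply: (@continuous_comp _ _ _ f (coord_fun i));
    first exact: (fs 0%N p Up).
  exact: coord_fun_continuous.
split=> [p Up|v].
  apply: (@differentiable_comp _ _ _ _ f (coord_fun i));
    first exact: smooth_differentiable fs Up.
  exact: differentiable_coord.
apply: (Ck_eq oU) (IH _ (smooth_derive v fs)) => p Up.
by rewrite derive_coord//; exact: smooth_differentiable fs Up.
Qed.

Lemma smooth_row n U (f : V -> 'rV[K]_n) : open U ->
  (forall i, smooth U (fun p => f p 0 i)) -> smooth U f.
Proof.
move=> oU fs.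
rewrite (_ : f = (fun p => \sum_i f p 0 i *: delta_mx 0 i)).
  by apply: (smooth_sum oU) => i k; apply: Ck_scalel => //; exact: fs.
by apply/funext => p; exact: row_sum_delta.
Qed.

End Coordinates.

(** * Jets over the plane *)

Lemma open_nonzero (K : numFieldType) (V : normedModType K) (U : set V) (f : V -> K) :
  open U -> smooth U f -> open [set p | U p /\ f p != 0].
Proof.
move=> oU fs; rewrite openE => p [Up fp0].
have fc : {for p, continuous f} by exact: differentiable_continuous
  (smooth_differentiable fs Up).
apply: filterI; first exact: open_nbhs_nbhs.
apply: (fc [set x | x != 0]).
exists `|f p|; first by rewrite /= normr_gt0.
by move=> y; rewrite /= => h; apply/eqP => y0; move: h; rewrite y0 subr0 ltxx.
Qed.

Lemma open_nonzero_scalars (K : numFieldType) : open [set s : K | s != 0].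
Proof.
rewrite (_ : mkset _ = [set s : K | setT s /\ s != 0]).
  by apply: open_nonzero; [exact: openT|exact: smooth_id].
by apply/seteqP; split=> p //= [].
Qed.

Section Plane.
Variable K : numFieldType.

Definition row2 (a b : K) : 'rV[K]_2 := \row_i (if (i : nat) == 0%N then a else b).

Lemma row2E0 a b : row2 a b 0 0 = a. Proof. by rewrite mxE. Qed.
Lemma row2E1 a b : row2 a b 0 1 = b. Proof. by rewrite mxE. Qed.
Lemma row2_eta (p : 'rV[K]_2) : p = row2 (p 0 0) (p 0 1).
Proof.
apply/rowP => i; rewrite mxE; case: i => [[|[|//]] h] /=; congr (p 0 _); exact: val_inj.
Qed.

Definition dt (f : 'rV[K]_2 -> K) p := 'D_(row2 1 0) f p.
Definition dx (f : 'rV[K]_2 -> K) p := 'D_(row2 0 1) f p.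

Lemma derive_row2 (f : 'rV[K]_2 -> K) p a b : differentiable f p ->
  'D_(row2 a b) f p = a * dt f p + b * dx f p.
Proof.
move=> fd; rewrite /dt /dx !deriveE //.
have -> : row2 a b = a *: row2 1 0 + b *: row2 0 1.
  by apply/rowP => i; rewrite !mxE; case: ifP => _; ring.
by rewrite linearP linearZ.
Qed.

Lemma smooth_dt U f : smooth U f -> smooth U (dt f).
Proof. exact: smooth_derive. Qed.
Lemma smooth_dx U f : smooth U f -> smooth U (dx f).
Proof. exact: smooth_derive. Qed.

Lemma det2 (A : 'M[K]_2) : \det A = A 0 0 * A 1 1 - A 0 1 * A 1 0.
Proof.
rewrite (expand_det_row _ 0) !big_ord_recl big_ord0 addr0 /cofactor !det_mx11 !mxE /=.
rewrite (_ : lift 0 0 = 1); last exact: val_inj.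
rewrite (_ : lift 1 0 = 0); last exact: val_inj.
by rewrite expr0 expr1 mul1r mulN1r mulrN.
Qed.

Lemma det_jacobian2 (f : 'rV[K]_2 -> 'rV[K]_2) p : differentiable f p ->
  \det ('J f p) = dt (fun q => f q 0 0) p * dx (fun q => f q 0 1) p -
                  dt (fun q => f q 0 1) p * dx (fun q => f q 0 0) p.
Proof.
move=> fd.
have E (v : 'rV_2) i : (v *m 'J f p) 0 i = 'D_v (fun q => f q 0 i) p.
  by rewrite -deriveEjacobian // derive_coord.
have Jt i : 'J f p 0 i = dt (fun q => f q 0 i) p.
  rewrite /dt -E [RHS]mxE !big_ord_recl big_ord0 (_ : lift ord0 ord0 = 1);
    last exact: val_inj.
  by rewrite row2E0 row2E1 mul1r mul0r !addr0.
have Jx i : 'J f p 1 i = dx (fun q => f q 0 i) p.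
  rewrite /dx -E [RHS]mxE !big_ord_recl big_ord0 (_ : lift ord0 ord0 = 1);
    last exact: val_inj.
  by rewrite row2E0 row2E1 mul1r mul0r add0r addr0.
by rewrite det2 !Jt !Jx.
Qed.

End Plane.

Section Jets.
Variables (K : numFieldType) (r : nat).
Hypothesis hr : (3 <= r)%N.
Local Notation jet := 'rV[K]_(2 + r).
Implicit Types (j : jet) (F G : jet -> K).
Local Notation Dt := (@total_derivative K r).

Lemma base_continuous : continuous (@base K r).
Proof. exact: continuous_lsubmx. Qed.

Lemma open_base D : open D -> open (@base K r @^-1` D).
Proof. by move=> oD; apply: open_comp => // ? _; exact: base_continuous. Qed.

Lemma xder0 j : xder 0 j = base j 0 1.
Proof. by rewrite mxE /xder; congr (j 0 _); apply: val_inj; rewrite /= inordK. Qed.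

Lemma base_contact j : base (contact_vector j) = row2 1 (xder 1 j).
Proof.
apply/rowP => i; rewrite !mxE /=; case: ifP => // i0.
have -> : (i : nat) = 1%N by case: i i0 => [[|[|]]].
by rewrite (leq_trans _ hr).
Qed.

Lemma Dt_base (f : 'rV[K]_2 -> K) j : differentiable f (base j) ->
  Dt (fun j => f (base j)) j = dt f (base j) + xder 1 j * dx f (base j).
Proof.
move=> fd; rewrite /total_derivative.
rewrite [LHS](derive_comp_linear lsubmx f).
rewrite [X in 'D_X f _](_ : _ = row2 1 (xder 1 j)); last exact: base_contact.
by rewrite derive_row2 // mul1r.
Qed.

Lemma smooth_base D (f : 'rV[K]_2 -> K) :
  smooth D f -> smooth (@base K r @^-1` D) (fun j => f (base j)).
Proof.
by move=> fs; apply: (smooth_comp_linear (L := lsubmx)) fs; exact: base_continuous.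
Qed.

Lemma smooth_xder U k : open U -> smooth U (@xder K r k).
Proof. exact: smooth_coord_fun. Qed.

(** The direction [contact_vector j] varies with [j], so [Dt F] is not a fixed directional
    derivative; it is expanded along the coordinate vectors, with the entries of the contact vector
    as smooth coefficients. *)
Lemma smooth_Dt U F : open U -> smooth U F -> smooth U (Dt F).
Proof.
move=> oU Fs.
apply: (@smooth_eq _ _ _ _ (fun j =>
  \sum_i contact_vector j 0 i * 'D_(delta_mx 0 i) F j)) => //.
  move=> j Uj; have Fd := smooth_differentiable Fs Uj.
  rewrite /total_derivative [in RHS]deriveE // [X in 'd F j X]row_sum_delta linear_sum.
  by apply: eq_bigr => i _; rewrite linearZ /= deriveE.
apply: (smooth_sum oU) => i; apply: smoothM => //; last exact: smooth_derive.
rewrite (_ : (fun j => _) = fun j => if (i : nat) == 0%N then 1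
    else if (i <= r)%N then xder i j else 0); last by apply/funext => j; rewrite mxE.
case: (i == 0%N :> nat); first exact: (smooth_cst (W := K)).
by case: (i <= r)%N; [exact: smooth_xder|exact: (smooth_cst (W := K))].
Qed.

Lemma Dt_eq U F G j : open U -> (forall j, U j -> F j = G j) -> U j -> Dt F j = Dt G j.
Proof.
by move=> oU FG Uj; apply: near_eq_derive; exact: near_open oU Uj FG.
Qed.

(** The bound is strict because jets stop at order r: the last entry of the contact vector is 0. *)
Lemma Dt_xder k j : (k < r)%N -> Dt (@xder K r k) j = xder k.+1 j.
Proof.
move=> kr; rewrite /total_derivative derive_coord_fun mxE /= inordK;
  last by rewrite ltnS ltnW // ltnS.
by rewrite /= kr.
Qed.

Lemma DtD U F G j : smooth U F -> smooth U G -> U j ->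
  Dt (fun j => F j + G j) j = Dt F j + Dt G j.
Proof.
by move=> Fs Gs Uj; apply: deriveD;
  [exact: smooth_derivable Fs _|exact: smooth_derivable Gs _].
Qed.

Lemma DtM U F G j : smooth U F -> smooth U G -> U j ->
  Dt (fun j => F j * G j) j = F j * Dt G j + Dt F j * G j.
Proof.
move=> Fs Gs Uj; rewrite [LHS]deriveM; first by rewrite [Dt F j * _]mulrC.
  exact: smooth_derivable Fs _.
exact: smooth_derivable Gs _.
Qed.

Lemma Dt_cst (c : K) j : Dt (fun=> c) j = 0.
Proof. exact: derive_cst. Qed.

Lemma Dt_sum U n (F : 'I_n -> jet -> K) j : (forall i, smooth U (F i)) -> U j ->
  Dt (fun j => \sum_i F i j) j = \sum_i Dt (F i) j.
Proof.
move=> Fs Uj; rewrite (_ : (fun j => _) = \sum_i F i); last first.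
  by apply/funext => j'; rewrite fct_sumE.
by rewrite [LHS]derive_sum// => i; exact: smooth_derivable (Fs i) _.
Qed.

Lemma DtX U F n j : smooth U F -> U j ->
  Dt (fun j => F j ^+ n) j = n%:R * F j ^+ n.-1 * Dt F j.
Proof.
move=> Fs Uj; rewrite (_ : (fun j => _) = F ^+ n); last by rewrite exprfctE.
rewrite [LHS](deriveX n); last exact: smooth_derivable Fs _.
by rewrite /GRing.scale /= -mulr_natl.
Qed.

Lemma DtV U F j : smooth U F -> U j -> F j != 0 ->
  Dt (fun j => (F j)^-1) j = - (F j ^- 2 * Dt F j).
Proof.
move=> Fs Uj F0; rewrite [LHS]deriveV //; last exact: smooth_derivable Fs _.
by rewrite scaleNr.
Qed.

Lemma arnold2_lhs0 j : arnold2_lhs 0 j = xder r j.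
Proof. by rewrite /arnold2_lhs big1 ?addr0 // => i _; rewrite mxE mul0r. Qed.

Definition mkjet (t x : K) (c : nat -> K) : jet :=
  \row_i (if (i : nat) == 0%N then t else if (i : nat) == 1%N then x else c i.-1).

Lemma base_mkjet t x c : base (mkjet t x c) = row2 t x.
Proof.
apply/rowP => i; rewrite !mxE /=; case: ifP => // i0.
by case: i i0 => [[|[|]]].
Qed.

Lemma xder_mkjet t x c k : (0 < k <= r)%N -> xder k (mkjet t x c) = c k.
Proof.
case: k => [|k] // /andP[_ kr]; rewrite /xder mxE /= inordK //.
Qed.

End Jets.

(** * Prolongation and ramification *)

Section Prolongation.
Variables (K : numFieldType) (r : nat).
Hypothesis hr : (3 <= r)%N.
Local Notation jet := 'rV[K]_(2 + r).
Implicit Types (j : jet) (F G : jet -> K).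
Local Notation Dt := (@total_derivative K r).

Variables (D : set 'rV[K]_2) (phi : 'rV[K]_2 -> 'rV[K]_2).
Hypotheses (oD : open D) (phis : smooth D phi).
Local Notation T := (fun p => phi p 0 0).
Local Notation X := (fun p => phi p 0 1).
Local Notation tau := (Dt (@Tcomp K r phi)).

(* pro k is the component X^(k) of the prolongation. *)
Definition pro k : jet -> K :=
  iter k (fun F j => Dt F j / tau j) (@Xcomp K r phi).

Definition regular_jets : set jet := [set j | D (base j) /\ tau j != 0].

Lemma time_prolong j : time (prolong phi j) = T (base j).
Proof. by rewrite /time !mxE. Qed.

Lemma xder_prolong k j : (k <= r)%N -> xder k (prolong phi j) = pro k j.
Proof. by move=> kr; rewrite /xder mxE /= inordK. Qed.

Lemma arnold2_lhs_prolong a j : arnold2_lhs a (prolong phi j) =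
  pro r j + \sum_(i < r - 2) a 0 i * pro i.+2 j.
Proof.
rewrite /arnold2_lhs xder_prolong //; congr (_ + _); apply: eq_bigr => i _.
by have := ltn_ord i; rewrite ltn_subRL add2n => /ltnW ir; rewrite xder_prolong.
Qed.

Lemma smooth_T : smooth D T. Proof. exact: smooth_coord. Qed.
Lemma smooth_X : smooth D X. Proof. exact: smooth_coord. Qed.

Lemma tauE j : D (base j) -> tau j = dt T (base j) + xder 1 j * dx T (base j).
Proof.
by move=> Dj; rewrite -(Dt_base hr) //; exact: smooth_differentiable smooth_T _.
Qed.

Lemma smooth_tau : smooth (@base K r @^-1` D) tau.
Proof. by apply: smooth_Dt; [exact: open_base|exact: smooth_base smooth_T]. Qed.

Lemma open_regular_jets : open regular_jets.
Proof. by apply: open_nonzero smooth_tau; exact: open_base. Qed.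

Lemma smooth_pro k : smooth regular_jets (pro k).
Proof.
have oR := open_regular_jets.
have sR : regular_jets `<=` @base K r @^-1` D by move=> j [].
elim: k => [|k IH].
  by apply: smooth_subset sR _; exact: smooth_base smooth_X.
apply: smoothM => //; first exact: smooth_Dt.
by apply: smoothV => //; [move=> j []|exact: smooth_subset sR smooth_tau].
Qed.

End Prolongation.

Arguments pro : simpl never.

Section ProjectableTime.
Variables (K : numFieldType) (r : nat).
Hypothesis hr : (3 <= r)%N.
Local Notation jet := 'rV[K]_(2 + r).
Implicit Types (j : jet) (F G : jet -> K).
Local Notation Dt := (@total_derivative K r).

Variables (D : set 'rV[K]_2) (phi : 'rV[K]_2 -> 'rV[K]_2).
Hypotheses (oD : open D) (phis : smooth D phi).
Local Notation T := (fun p => phi p 0 0).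
Local Notation X := (fun p => phi p 0 1).
Local Notation tau := (Dt (@Tcomp K r phi)).
Local Notation W := (@base K r @^-1` D).

(* numerator n = (D_t T)^(2n+1) X^(n+1), extended to the jets where D_t T = 0. *)
Fixpoint numerator n : jet -> K :=
  if n is n'.+1 then fun j => tau j * Dt (numerator n') j -
                      (2 * n' + 1)%:R * (Dt tau j * numerator n' j)
  else Dt (@Xcomp K r phi).

Lemma smooth_numerator n : smooth W (numerator n).
Proof.
have oW := open_base (r := r) oD; have ts := smooth_tau r oD phis.
elim: n => [|n IH] /=.
  by apply: smooth_Dt => //; exact: smooth_base (smooth_X oD phis).
apply: smoothB => //; first by apply: smoothM => //; exact: smooth_Dt.
apply: smoothM => //; first exact: (smooth_cst (W := K)).
by apply: smoothM => //; exact: smooth_Dt.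
Qed.

(** Quotient rule: applying D_t to N / tau^(2n+1) and dividing by tau gives (tau D_t N - (2n+1) N
    D_t tau) / tau^(2n+3), which is the recursion of [numerator]. *)
Lemma pro_numerator n j : D (base j) -> tau j != 0 ->
  pro phi n.+1 j = numerator n j / tau j ^+ (2 * n + 1).
Proof.
have oR := open_regular_jets (r := r) oD phis.
have sR : regular_jets D phi `<=` W by move=> j' [].
have ts := smooth_subset sR (smooth_tau r oD phis).
elim: n j => [|n IH] j Dj t0; first by rewrite muln0 add0n expr1.
have Rj : regular_jets D phi j by [].
rewrite /pro iterS -/(pro phi n.+1) [in LHS](Dt_eq (G := fun j =>
  numerator n j * (tau j ^+ (2 * n + 1))^-1) oR) //; last first.
  by move=> j' [Dj' t0']; exact: IH.
have ns : smooth (regular_jets D phi) (numerator n) by exact: smooth_subset sR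
  (smooth_numerator n).
have tXs : smooth (regular_jets D phi) (fun j => tau j ^+ (2 * n + 1)) by exact: smoothX.
rewrite (DtM ns _ Rj); last first.
  by apply: smoothV => // j' [_ ?]; rewrite expf_neq0.
rewrite (DtV tXs Rj) ?expf_neq0 // (DtX _ ts Rj) /=.
rewrite addn1 /= mulnS add2n !addSn ?addn1 !exprS.
have s0 : tau j ^+ (2 * n) != 0 by rewrite expf_neq0.
move: (tau j ^+ (2 * n)) s0 => s s0.
rewrite expr0 mulr1; set c := (2 * n).+1%:R.
by field; rewrite s0 t0.
Qed.

(** Carries the target equation, cleared of denominators, over to the jet where D_t T = 0 and the
    prolongation has no meaning. *)
Lemma continuous_zero (g : K -> K) y0 : {for y0, continuous g} ->
  (forall y, y != y0 -> g y = 0) -> g y0 = 0.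
Proof.
move=> /continuous_withinNx gc g0.
have -> : g y0 = lim (g @ y0^') by apply/esym/cvg_lim => //; exact: norm_hausdorff.
apply/cvg_lim; first exact: norm_hausdorff.
by apply: cvg_near_cst; near=> y; apply: g0; near: y; exact: nbhs_dnbhs_neq.
Unshelve. all: by end_near. Qed.

(** At such a jet the recursion reduces to multiplication by -(2n+1), which is nonzero in
    characteristic 0. *)
Lemma numerator_ramified n j : tau j = 0 -> Dt tau j = 1 -> numerator 0 j != 0 ->
  numerator n j != 0.
Proof.
move=> t0 t1 n0; elim: n => [//|n IH] /=.
by rewrite t0 t1 mul0r sub0r oppr_eq0 mul1r mulf_neq0 // pnatr_eq0 addn1.
Qed.

(* At a jet where D_t T vanishes while D_t^2 T does not, X^(k) has a pole of
   exact order 2k - 1 in D_t T. *)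
Lemma projectable_time (a a' : 'rV[K]_(r - 2)) (b b' : K) p : D p ->
  dt T p * dx X p - dt X p * dx T p != 0 ->
  (forall j, base j = p -> tau j != 0 -> arnold2_lhs a j = b ->
     arnold2_lhs a' (prolong phi j) = b') ->
  dx T p = 0.
Proof.
move=> Dp jac maps; apply/eqP/negPn/negP => Tx0.
have oW := open_base (r := r) oD.
(* [ys] is the slope x' at which D_t T = T_t + x' T_x vanishes. There D_t^2 T = [A] + x'' T_x, and
   [c] is the value of x'' that makes this 1. *)
pose ys := - dt T p / dx T p.
pose v := row2 1 ys.
pose A := 'D_v (dt T) p + ys * 'D_v (dx T) p.
pose c := (1 - A) / dx T p.
(* x^(r) is solved from the source equation; r >= 3 keeps it apart from x''. Only the a_2 term, of
   index 0, survives in the sum, since the derivatives between x'' and x^(r) are set to 0. *)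
pose top := b - \sum_(i < r - 2) a 0 i * (if (i : nat) == 0%N then c else 0).
pose cs y k := if k == 1%N then y else if k == 2%N then c else if k == r then top else 0.
pose J (y : K) : jet := mkjet r (p 0 0) (p 0 1) (cs y).
have bJ y : base (J y) = p by rewrite base_mkjet // -row2_eta.
have x1 y : xder 1 (J y) = y by rewrite xder_mkjet //= (leq_trans _ hr).
have x2 y : xder 2 (J y) = c by rewrite xder_mkjet //= (leq_trans _ hr).
have EJ y : arnold2_lhs a (J y) = b.
  rewrite /arnold2_lhs xder_mkjet ?leqnn ?(leq_trans _ hr) // /cs eqxx.
  have -> : (r == 1%N) = false by apply/eqP => r1; move: hr; rewrite r1.
  have -> : (r == 2%N) = false by apply/eqP => r1; move: hr; rewrite r1.
  rewrite /top -[RHS](subrK (\sum_(i < r - 2) a 0 i * (if (i : nat) == 0%N then c else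
    0))).
  congr (_ + _); apply: eq_bigr => i _; congr (_ * _).
  have := ltn_ord i; rewrite ltn_subRL add2n => ir.
  rewrite xder_mkjet ?(ltnW ir) // /cs (ltn_eqF ir).
  by case: (nat_of_ord i) => [|[]].
have tJ y : tau (J y) = (y - ys) * dx T p.
  rewrite (tauE hr oD phis) bJ // x1 /ys; field; exact: Tx0.
have tJ0 : tau (J ys) = 0 by rewrite tJ subrr mul0r.
have Ts := smooth_T oD phis.
have ttJ : Dt tau (J ys) = 1.
  rewrite (Dt_eq (G := fun j => dt T (base j) + xder 1 j * dx T (base j)) oW); last first.
  - by rewrite /= bJ.
  - by move=> j Dj; exact: (tauE hr oD phis).
  have WJ : W (J ys) by rewrite /= bJ.
  have dts := smooth_base r (smooth_dt Ts).
  have dxs := smooth_base r (smooth_dx Ts).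
  have xs := smooth_xder 1 oW.
  rewrite (DtD dts (smoothM oW xs dxs) WJ) (DtM xs dxs WJ).
  rewrite (Dt_xder (k := 1)) ?(leq_trans _ hr) // x2 x1 bJ.
  have bc : base (contact_vector (J ys)) = v by rewrite base_contact // x1.
  have DB f : Dt (fun j => f (base j)) (J ys) = 'D_v f p.
    rewrite /total_derivative [LHS](derive_comp_linear lsubmx f).
    rewrite [X in 'D_X f _](_ : _ = v); last exact: bc.
    by rewrite [X in 'D_v f X](_ : _ = p) //; exact: bJ.
  by rewrite (DB (dt T)) (DB (dx T)) addrA -/A /c divfK // addrC subrK.
(* At the slope [ys] the Jacobian equals - T_x D_t X, so D_t X is nonzero. *)
have n0 : numerator 0 (J ys) != 0.
  rewrite -[numerator 0]/(Dt (fun j => X (base j))) (Dt_base hr);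
    last by apply: smooth_differentiable (smooth_X oD phis) _; rewrite bJ.
  rewrite bJ x1 /ys; apply: contra jac => /eqP h.
  apply/eqP; rewrite (_ : _ - _ = - dx T p * (dt X p + - dt T p / dx T p * dx X p));
    last by field.
  by rewrite h mulr0.
(* The target equation times (D_t T)^(2r-1). Every term but the first keeps a positive power of D_t
   T; [numerator] is indexed one below the order of the derivative. *)
pose G (y : K) : K := numerator r.-1 (J y) +
  \sum_(i < r - 2) a' 0 i * (numerator i.+1 (J y) * tau (J y) ^+ (2 * (r - i.+2)))
  - b' * tau (J y) ^+ (2 * r.-1 + 1).
have G0 y : y != ys -> G y = 0.
  move=> yys; have tJn : tau (J y) != 0 by rewrite tJ mulf_neq0 // subr_eq0.
  have := maps (J y) (bJ y) tJn (EJ y).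
  have -> : arnold2_lhs a' (prolong phi (J y)) = pro phi r.-1.+1 (J y) +
      \sum_(i < r - 2) a' 0 i * pro phi i.+2 (J y).
    by rewrite arnold2_lhs_prolong prednK // (leq_trans _ hr).
  rewrite pro_numerator ?bJ // => E.
  rewrite /G -E mulrDl divfK ?expf_neq0 // opprD addrACA subrr add0r mulr_suml.
  rewrite -sumrB big1 // => i _.
  have := ltn_ord i; rewrite ltn_subRL add2n => ir.
  rewrite pro_numerator ?bJ // -!mulrA -mulrBr.
  rewrite (_ : (2 * r.-1 + 1 = (2 * i.+1 + 1) + 2 * (r - i.+2))%N); last by lia.
  by rewrite (exprD _ (2 * i.+1 + 1)) mulKf ?expf_neq0 // subrr mulr0.
have Gc : {for ys, continuous G}.
  have oT : open [set: K] by exact: openT.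
  have Js : smooth [set: K] J.
    apply: smooth_row => // i.
    rewrite (_ : (fun y => _) = fun y => if (i : nat) == 0%N then p 0 0 else
      if (i : nat) == 1%N then p 0 1 else cs y i.-1); last by apply/funext => y;
        rewrite mxE.
    rewrite /cs; case: (i == 0%N :> nat); first exact: (smooth_cst (W := K)).
    case: (i == 1%N :> nat); first exact: (smooth_cst (W := K)).
    case: (i.-1 == 1%N); last exact: (smooth_cst (W := K)).
    exact: smooth_id.
  have Jc : {for ys, continuous J}.
    exact: differentiable_continuous (smooth_differentiable Js _).
  have ts := smooth_tau r oD phis.
  apply: (@continuous_comp _ _ _ J (fun j => numerator r.-1 j +
    \sum_(i < r - 2) a' 0 i * (numerator i.+1 j * tau j ^+ (2 * (r - i.+2)))
    - b' * tau j ^+ (2 * r.-1 + 1))) => //.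
  apply: differentiable_continuous; apply: (@smooth_differentiable _ _ _ W);
    last by rewrite /= bJ.
  have Ks c0 : smooth W (fun=> c0 : K) by exact: (smooth_cst (W := K)).
  apply: smoothB => //; last by apply: smoothM => //; exact: smoothX.
  apply: smoothD => //; first exact: smooth_numerator.
  apply: smooth_sum => // i; apply: smoothM => //; apply: smoothM => //.
    exact: smooth_numerator.
  exact: smoothX.
have := continuous_zero Gc G0.
rewrite /G tJ0 expr0n addn1 /= mulr0 subr0 big1 => [|i _]; last first.
  have := ltn_ord i; rewrite ltn_subRL add2n => ir.
  by rewrite expr0n (_ : (_ == _) = false) ?mulr0 //; apply/eqP; lia.
by rewrite addr0; apply/eqP; exact: numerator_ramified.
Qed.

End ProjectableTime.

(** * Functions of t alone *)

(* The only consequence of completeness needed; both R and R[i] enjoy it, whereas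
   the mean value theorem fails over R[i]. *)
Definition flat_constant (K : numFieldType) := forall f : K -> K,
  (forall s : K, 0 <= s <= 1 -> is_derive s 1 f 0) -> f 1 = f 0.

Lemma real_flat_constant (R : realType) : flat_constant R.
Proof.
move=> f fd.
have h01 : 0 <= 1 :> R by [].
have [||c _] := @MVT_segment R f (fun=> 0) 0 1 h01.
- by move=> x /andP[x0 x1]; apply: fd; move: x0 x1; rewrite !bnd_simp => /ltW -> /ltW.
- apply: continuous_in_subspaceT => x; rewrite inE /= in_itv /= => x01.
  by have [fx _] := fd x x01; apply: differentiable_continuous; exact/derivable1_diffP.
- by rewrite mul0r => /eqP; rewrite subr_eq0 => /eqP.
Qed.

Section ComplexFlat.
Variable R : realType.
Local Open Scope complex_scope.

Let C : numFieldType := R[i].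

(** [P] stands for the real or the imaginary part. Being real-linear and bounded by the modulus, it
    turns the complex difference quotients at real points into real ones that still tend to 0. *)
Lemma flat_constant_part (P : {additive R[i] -> R}) (f : C -> C) :
  (forall z : R[i], `|P z|%:C <= `|z|) -> (forall a z, P (a%:C * z) = a * P z) ->
  (forall s : C, 0 <= s <= 1 -> is_derive s 1 f 0) -> P (f 1) = P (f 0).
Proof.
move=> Pn PZ fd; pose g (s : R) := P (f s%:C).
suff : g 1 = g 0 by [].
apply: real_flat_constant => s s01.
have sC : 0 <= s%:C <= 1 by rewrite -[1]/(1%:C) -[0]/(0%:C) !lecR.
have [fdv fd0] := fd _ sC.
have fcv : (fun h : C => h^-1 *: (f (h *: 1 + s%:C) - f s%:C)) @ 0^' --> (0 : C).
  by rewrite -[X in _ --> X]fd0; exact: fdv.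
have gcv : (fun h : R => h^-1 *: (g (h *: 1 + s) - g s)) @ 0^' --> (0 : R).
  apply/cvgrPdist_lt => e e0.
  have eC0 : 0 < e%:C by rewrite -[0]/(0%:C) ltcR.
  move/cvgrPdist_lt/(_ _ eC0) : fcv => [d /= d0 dP].
  (* A positive element of [R[i]] is real, so the complex radius [d] is also a radius in [R]. *)
  have dr : d = (complex.Re d)%:C by rewrite RRe_real ?gtr0_real.
  exists (complex.Re d) => /=; first by move: d0; rewrite dr -[0]/(0%:C) ltcR.
  move=> h; rewrite /ball_ /= => hd h0.
  have hC : h%:C != 0 by rewrite -[0]/(0%:C) (inj_eq (@complexI R)).
  have hdC : `|0 - h%:C| < d.
    by move: hd; rewrite !sub0r !normrN dr normc_def /= expr0n addr0 sqrtr_sqr ltcR.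
  have := dP h%:C hdC hC; rewrite /= !sub0r !normrN => H.
  rewrite -ltcR; apply: le_lt_trans H; apply: le_trans (Pn _).
  rewrite lecR -[_ *: (_ - f _)]/(_ * _) -[h%:C^-1]fmorphV PZ /=.
  have -> : h%:C%:A + s%:C = (h%:A + s)%:C.
    by rewrite -[h%:C%:A]/(h%:C * 1) -[h%:A]/(h * 1) !mulr1 rmorphD.
  by rewrite [P _]raddfB.
by apply: DeriveDef; [apply/cvg_ex; exists 0|apply/cvg_lim].
Qed.

Lemma complex_flat_constant : flat_constant R[i].
Proof.
move=> f fd; apply/eqP; rewrite eq_complex; apply/andP; split; apply/eqP.
  by apply: (flat_constant_part (P := @complex.Re R)) fd;
    [exact: normc_ge_Re|move=> a [x y] /=; ring].
apply: (flat_constant_part (P := @complex.Im R)) fd; last by move=> a [x y] /=; ring.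
move=> [x y]; rewrite normc_def lecR /= -sqrtr_sqr ler_sqrt ?lerDr ?sqr_ge0 //.
by rewrite addr_ge0 ?sqr_ge0.
Qed.

End ComplexFlat.

Lemma continuous_addr (K : numFieldType) (V : normedModType K) (w : V) :
  continuous (fun q : V => q + w).
Proof. by move=> p; apply: cvgD; [apply: cvg_id|exact: cvg_cst]. Qed.

Lemma differentiable_line (K : numFieldType) (V : normedModType K) (v p : V) s :
  differentiable (fun h : K => h *: v + p) s.
Proof.
apply: differentiableD => //; apply: differentiableZl.
Qed.

Lemma continuous_line (K : numFieldType) (V : normedModType K) (v p : V) :
  continuous (fun h : K => h *: v + p).
Proof. by move=> s; exact: differentiable_continuous (differentiable_line v p s). Qed.

Lemma derive_line (K : numFieldType) (V W : normedModType K) (f : V -> W) (v p : V) s :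
  differentiable f (s *: v + p) ->
  is_derive s (1 : K) (fun h : K => f (h *: v + p)) ('D_v f (s *: v + p)).
Proof.
move=> fd; apply: DeriveDef.
  by apply: diff_derivable; exact: (@differentiable_comp _ _ _ _ (fun h : K =>
    h *: v + p) f _ (differentiable_line v p s)).
rewrite /derive /=.
by under [in LHS]eq_fun do rewrite [_%:A]mulr1 scalerDl -addrA.
Qed.

Lemma constant_quadratic (K : numFieldType) (a b c d : K) :
  (forall y, a + y * b + y ^+ 2 * c = d) -> [/\ c = 0, b = 0 & a = d].
Proof.
move=> h; have := h 0; rewrite mul0r expr0n mul0r !addr0 => ad.
have := h 1; have := h (-1); rewrite mul1r mulN1r sqrrN expr1n mul1r -ad => hN h1.
have two0 : (2 : K) != 0 by rewrite pnatr_eq0.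
have c0 : c = 0.
  apply: (mulfI two0); transitivity ((a + b + c) + (a - b + c) - 2 * a); first by ring.
  by rewrite h1 hN; ring.
by split=> //; transitivity (a + b + c - a - c); [ring|rewrite h1 c0; ring].
Qed.

(** Provides the segments along which [flat_xindep] integrates a zero x-derivative. *)
Definition vertically_convex (K : numFieldType) (B : set 'rV[K]_2) :=
  forall p q s, B p -> B q -> p 0 0 = q 0 0 -> 0 <= s <= 1 -> B (p + s *: (q - p)).

Section Vertical.
Variable K : numFieldType.
Hypothesis flatK : flat_constant K.
Variable B : set 'rV[K]_2.
Hypothesis oB : open B.
Hypothesis vB : vertically_convex B.
Implicit Types f g : 'rV[K]_2 -> K.

(** A function of t alone on [B], kept as a function on the plane so that [dt] still applies to
    it. *)
Definition xindep f := forall p q, B p -> B q -> p 0 0 = q 0 0 -> f p = f q.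

(** Near [p], [f] agrees with its translate by the vertical vector q - p, so the derivatives at [p]
    and [q] coincide. *)
Lemma xindep_derive f v : xindep f -> xindep (fun p => 'D_v f p).
Proof.
move=> fi p q Bp Bq pq.
rewrite (_ : 'D_v f q = 'D_v (fun u => f (u + (q - p))) p); last first.
  rewrite /derive; set a := (fun _ : K => _); set b := (fun _ : K => _).
  suff -> : a = b by [].
  by apply/funext => h; rewrite /a /b /= -addrA ![p + _]addrC !subrK.
apply: near_eq_derive; near=> u.
have Bu : B u by near: u; exact: open_nbhs_nbhs.
apply: fi => //; last by rewrite !mxE pq subrr addr0.
near: u.
have c : {for p, continuous (fun u : 'rV[K]_2 => u + (q - p))}.
  exact: continuous_addr.
apply: c; apply: open_nbhs_nbhs; split => //=.
by rewrite addrC subrK.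
Unshelve. all: by end_near. Qed.

Lemma dx_xindep f p : xindep f -> B p -> dx f p = 0.
Proof.
move=> fi Bp; rewrite /dx /derive; apply/cvg_lim; first exact: norm_hausdorff.
apply: cvg_near_cst; apply: cvg_within; near=> h => /=.
rewrite (fi _ p) ?subrr ?scaler0 //; last by rewrite !mxE /= mulr0 add0r.
near: h.
have c := @continuous_line K _ (row2 0 1) p 0.
by apply: c; apply: open_nbhs_nbhs; split => //=; rewrite scale0r add0r.
Unshelve. all: by end_near. Qed.

Lemma flat_xindep f : smooth B f -> (forall p, B p -> dx f p = 0) -> xindep f.
Proof.
move=> fs f0 p q Bp Bq pq.
have E s : s *: (q - p) + p = p + s *: (q - p) by rewrite addrC.
have fp : f p = f (0 *: (q - p) + p) by rewrite scale0r add0r.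
have fq : f q = f (1 *: (q - p) + p) by rewrite scale1r subrK.
rewrite fp fq; apply/esym/(@flatK (fun s => f (s *: (q - p) + p))) => s s01.
have Bs : B (s *: (q - p) + p) by rewrite E; exact: vB.
apply: (is_derive_eq (derive_line (smooth_differentiable fs Bs))).
move: (_ + p) Bs => u Bu.
have -> : q - p = row2 0 (q 0 1 - p 0 1).
  by rewrite [LHS]row2_eta !mxE pq subrr.
rewrite derive_row2; last exact: smooth_differentiable fs Bu.
by rewrite f0 // mul0r mulr0 addr0.
Qed.

(** An elementary route to the symmetry of mixed derivatives when f_x = m depends on t alone: f - m
    x is then independent of x, and so is its t-derivative f_t - m_t x. *)
Lemma dx_dt f m : smooth B f -> smooth B m -> xindep m ->
  (forall p, B p -> dx f p = m p) -> forall p, B p -> dx (dt f) p = dt m p.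
Proof.
move=> fs ms mi fm p Bp.
pose x := fun q : 'rV[K]_2 => q 0 1.
have xs : smooth B x by exact: smooth_coord_fun.
have xm : smooth B (fun q => m q * x q) by exact: smoothM.
have dm u v : B u -> 'D_v (fun q => m q * x q) u = m u * v 0 1 + x u * 'D_v m u.
  move=> Bu; rewrite [LHS]deriveM;
    [|exact: smooth_derivable ms Bu|exact: smooth_derivable xs Bu].
  by rewrite derive_coord_fun.
pose g := fun q => f q - m q * x q.
have gs : smooth B g by exact: smoothB.
have gD u v : B u -> 'D_v g u = 'D_v f u - (m u * v 0 1 + x u * 'D_v m u).
  move=> Bu; rewrite -dm // [LHS]deriveB //; first exact: smooth_derivable fs Bu.
  exact: smooth_derivable xm Bu.
have gi : xindep g.
  apply: flat_xindep => // u Bu; rewrite /dx gD // -/(dx f u) -/(dx m u) fm //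
    dx_xindep //.
  by rewrite mulr0 addr0 row2E1 mulr1 subrr.
have := dx_xindep (xindep_derive (row2 1 0) gi) Bp.
have dms := smooth_dt ms.
have xdm : smooth B (fun q => x q * dt m q) by exact: smoothM.
rewrite /dx (near_eq_derive (g := fun u => dt f u - x u * dt m u)); last first.
  by apply: near_open oB Bp _ => u Bu; rewrite gD // row2E1 mulr0 add0r.
rewrite [X in X = _ -> _]deriveB;
  [|exact: smooth_derivable (smooth_dt fs) Bp|exact: smooth_derivable xdm Bp].
rewrite [X in _ - X = _ -> _]deriveM;
  [|exact: smooth_derivable xs Bp|exact: smooth_derivable dms Bp].
rewrite derive_coord_fun row2E1 -[X in x p *: X]/(dx (dt m) p).
rewrite (dx_xindep (xindep_derive (row2 1 0) mi) Bp) scaler0 add0r.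
by rewrite -[X in _ - X]/(dt m p * 1) mulr1 => /eqP; rewrite subr_eq0 => /eqP.
Qed.

Lemma xindepM f g : xindep f -> xindep g -> xindep (fun p => f p * g p).
Proof. by move=> fi gi p q Bp Bq pq; rewrite (fi p q) // (gi p q). Qed.

Lemma dtM f g p : smooth B f -> smooth B g -> B p ->
  dt (fun q => f q * g q) p = f p * dt g p + dt f p * g p.
Proof.
move=> fs gs Bp; rewrite /dt [LHS]deriveM; first by rewrite [_ *: 'D_ _ f p]mulrC.
  exact: smooth_derivable fs Bp.
exact: smooth_derivable gs Bp.
Qed.

Lemma dxM f g p : smooth B f -> smooth B g -> B p ->
  dx (fun q => f q * g q) p = f p * dx g p + dx f p * g p.
Proof.
move=> fs gs Bp; rewrite /dx [LHS]deriveM; first by rewrite [_ *: 'D_ _ f p]mulrC.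
  exact: smooth_derivable fs Bp.
exact: smooth_derivable gs Bp.
Qed.

Lemma derive_eqB f g p v : (forall q, B q -> f q = g q) -> B p -> 'D_v f p = 'D_v g p.
Proof. by move=> fg Bp; apply: near_eq_derive; exact: near_open oB Bp fg. Qed.

Variables (T X : 'rV[K]_2 -> K) (beta : K -> K).
Hypotheses (Ts : smooth B T) (Xs : smooth B X).
Hypothesis Tx0 : forall p, B p -> dx T p = 0.
Hypothesis Tt0 : forall p, B p -> dt T p != 0.
(* The second derivative of the image of the line of slope y through p. *)
Hypothesis lines : forall p y, B p ->
  'D_(row2 1 y) (fun q => 'D_(row2 1 y) X q / dt T q) p = dt T p * beta (T p).

(** Along a line of slope y the quotient X' / T' is g + y k, so [lines] equates a quadratic
    polynomial in y with a quantity free of y. Hence k_x = 0, g_x = - k_t and g_t = T_t beta(T). The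
    last is independent of x, so k_tt = - g_tx = 0. Computing X_tx from X_x = k T_t and from X_t = g
    T_t gives T_tt k = - 2 T_t k_t. *)
Lemma lines_to_lines : let k := fun p => dx X p / dt T p in
  [/\ xindep T, xindep k & forall p, B p ->
      dt (dt k) p = 0 /\ dt (dt T) p * k p = - 2 * dt T p * dt k p].
Proof.
move=> k; pose g := fun p => dt X p / dt T p.
have Ti := flat_xindep Ts Tx0.
have dTs := smooth_dt Ts.
have dTi : xindep (dt T) := xindep_derive _ Ti.
have Vs : smooth B (fun p => (dt T p)^-1) by exact: smoothV.
have ks : smooth B k by apply: smoothM => //; exact: smooth_dx.
have gs : smooth B g by apply: smoothM => //; exact: smooth_dt.
have dr := @smooth_differentiable K _ _ B _ _.
have lin p y : B p -> dt g p + y * (dx g p + dt k p) + y ^+ 2 * dx k p = dt T p * beta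
  (T p).
  move=> Bp; rewrite -(lines y Bp).
  rewrite (@derive_eqB _ (fun q => g q + y * k q)) //; last first.
    by move=> q Bq; rewrite derive_row2 ?mul1r ?mulrDl -?mulrA //; exact: dr Xs Bq.
  have yks : smooth B (fun q => y * k q) by apply: smoothM => //;
    exact: (smooth_cst (W := K)).
  rewrite [RHS]deriveD; [|exact: smooth_derivable gs Bp|exact: smooth_derivable yks Bp].
  rewrite [X in _ = _ + X]deriveMl; last exact: smooth_derivable ks Bp.
  rewrite !derive_row2; [|exact: dr ks Bp|exact: dr gs Bp].
  by move: (dt g p) (dx g p) (dt k p) (dx k p) => a b c d; ring.
have lin0 p : B p -> [/\ dx k p = 0, dx g p = - dt k p & dt g p = dt T p * beta (T p)].
  move=> Bp; have [-> /eqP + ->] := constant_quadratic (fun y => lin p y Bp).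
  by rewrite addr_eq0 => /eqP.
have ki : xindep k by apply: flat_xindep => // p /lin0[].
have dks := smooth_dt ks.
have dki : xindep (dt k) := xindep_derive _ ki.
have XE p : B p -> dx (dt X) p = k p * dt (dt T) p + dt k p * dt T p.
  move=> Bp; rewrite (@dx_dt _ (fun p => k p * dt T p)) ?dtM //.
  - exact: smooth_dx.
  - exact: smoothM.
  - exact: xindepM.
  - by move=> q Bq; rewrite /k divfK ?Tt0.
have gE p : B p -> dx (dt X) p = dt T p * dx g p.
  move=> Bp; rewrite /dx (@derive_eqB _ (fun q => g q * dt T q)) //; last first.
    by move=> q Bq; rewrite /g divfK ?Tt0.
  by rewrite -/(dx _ _) dxM // (dx_xindep dTi) // mulr0 add0r mulrC.
split => // p Bp; have [k0 g0 g1] := lin0 p Bp.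
have ndks : smooth B (fun p => -1 * dt k p) by apply: smoothM => //;
  exact: (smooth_cst (W := K)).
split.
  have dgi : xindep (dt g).
    move=> u v Bu Bv uv; have [_ _ ->] := lin0 u Bu; have [_ _ ->] := lin0 v Bv.
    by rewrite (Ti u v) // (dTi u v).
  have h : dx (dt g) p = dt (fun p => -1 * dt k p) p.
    apply: (@dx_dt g (fun p => -1 * dt k p) gs ndks _ _ p Bp);
      first by move=> u v Bu Bv uv; rewrite (dki u v Bu Bv uv).
    by move=> q Bq; have [_ -> _] := lin0 q Bq; exact/esym/mulN1r.
  move: h; rewrite (dx_xindep dgi Bp) [X in _ = X]deriveMl;
    last exact: smooth_derivable dks Bp.
  by rewrite -/(dt (dt k) p) mulN1r => /esym/eqP; rewrite oppr_eq0 => /eqP.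
have := XE p Bp; rewrite (gE p Bp) g0 => h.
move: (dt (dt T) p) (k p) (dt T p) (dt k p) h => a b c d h.
by transitivity (b * a + d * c - d * c); [ring|rewrite -h; ring].
Qed.

End Vertical.

(** * Equivalence transformations *)

(** Relates derivatives taken in different spaces or at different base points, from agreement along
    the two lines alone. *)
Lemma derive_eq_along (K : numFieldType) (V V' W : normedModType K) (f : V -> W) (g :
  V' -> W)
    (p v : V) (q w : V') :
  (\forall h \near (0 : K), f (h *: v + p) = g (h *: w + q)) -> 'D_v f p = 'D_w g q.
Proof.
move=> fg; have fgp : f p = g q.
  by have := nbhs_singleton fg; rewrite !scale0r !add0r.
rewrite /derive; congr (lim _).
rewrite eqEsubset; split; apply/near_eq_cvg/cvg_within; apply: filterS fg => h /= E.
  by rewrite fgp E.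
by rewrite fgp E.
Qed.

Section Dependence.
Variables (K : numFieldType) (r : nat).
Hypothesis hr : (3 <= r)%N.
Local Notation jet := 'rV[K]_(2 + r).
Implicit Types (j : jet) (F G : jet -> K).
Local Notation Dt := (@total_derivative K r).
Variable B : set 'rV[K]_2.
Hypothesis oB : open B.
Local Notation W := (@base K r @^-1` B).

(* Coordinates of index less than n: t, x, ..., x^(n - 2). *)
Definition depends_below n G := forall j j', W j -> W j' ->
  (forall i : 'I_(2 + r), (i < n)%N -> j 0 i = j' 0 i) -> G j = G j'.

Lemma base_near j v : W j -> \forall h \near (0 : K), W (h *: v + j).
Proof.
move=> Wj; have oW := open_base (r := r) oB.
have c := @continuous_line K _ v j 0.
by apply: c; apply: open_nbhs_nbhs; split => //=; rewrite scale0r add0r.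
Qed.

(** The entry of the contact vector at a positive index is the next coordinate, or 0 at the end, so
    differentiating along it reads one more coordinate. *)
Lemma depends_below_Dt n G : depends_below n G -> depends_below n.+1 (Dt G).
Proof.
move=> dG j j' Wj Wj' jj; apply: derive_eq_along; near=> h.
apply: dG; [by near: h; exact: base_near|by near: h; exact: base_near|].
move=> i ni; rewrite !mxE jj //; last exact: ltnW.
congr (_ * _ + _); case: ifP => // _; case: ifP => // ir.
by rewrite /xder jj // inordK.
Unshelve. all: by end_near. Qed.

Lemma depends_below_le m n G : (m <= n)%N -> depends_below m G -> depends_below n G.
Proof. by move=> mn dG j j' Wj Wj' jj; apply: dG => // i im; apply: jj;
  exact: leq_trans mn. Qed.

Lemma depends_below_xder k n : (k <= r)%N -> (k.+1 < n)%N -> depends_below n (@xder K r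
  k).
Proof. by move=> kr kn j j' _ _ jj; rewrite /xder jj // inordK. Qed.

Lemma depends_below_base n (f : 'rV[K]_2 -> K) : (1 < n)%N ->
  depends_below n (fun j => f (base j)).
Proof.
move=> n1 j j' _ _ jj; congr f; rewrite [base j]row2_eta [base j']row2_eta.
by congr row2; rewrite !mxE jj //= (leq_trans _ n1).
Qed.

Lemma depends_belowD n F G : depends_below n F -> depends_below n G ->
  depends_below n (fun j => F j + G j).
Proof. by move=> dF dG j j' Wj Wj' jj; rewrite (dF j j') // (dG j j'). Qed.

Lemma depends_belowM n F G : depends_below n F -> depends_below n G ->
  depends_below n (fun j => F j * G j).
Proof. by move=> dF dG j j' Wj Wj' jj; rewrite (dF j j') // (dG j j'). Qed.

End Dependence.

Section FiberPreserving.
Variables (K : numFieldType) (r : nat).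
Hypothesis hr : (3 <= r)%N.
Local Notation jet := 'rV[K]_(2 + r).
Implicit Types (j : jet) (F G : jet -> K).
Local Notation Dt := (@total_derivative K r).
Variables (B : set 'rV[K]_2) (phi : 'rV[K]_2 -> 'rV[K]_2).
Hypotheses (oB : open B) (phis : smooth B phi).
Local Notation W := (@base K r @^-1` B).
Local Notation T := (fun p => phi p 0 0).
Local Notation X := (fun p => phi p 0 1).
Local Notation tau := (Dt (@Tcomp K r phi)).
Hypothesis Tx0 : forall p, B p -> dx T p = 0.
Hypothesis Tt0 : forall p, B p -> dt T p != 0.

Lemma tau_dt j : W j -> tau j = dt T (base j).
Proof. by move=> Wj; rewrite (tauE hr oB phis) // Tx0 // mulr0 addr0. Qed.

(** Each step differentiates the top term and divides by T_t. The remainder reads indices up to n+1,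
    that is derivatives up to x^(n), so the prolongation is triangular; this is what separates the
    coefficients of a target equation. *)
Lemma pro_top n : (n < r)%N -> exists G,
  [/\ smooth W G, depends_below B n.+2 G & forall j, W j ->
      pro phi n.+1 j = dx X (base j) / dt T (base j) ^+ n.+1 * xder n.+1 j + G j].
Proof.
have oW := open_base (r := r) oB.
have Ts := smooth_T oB phis; have Xs := smooth_X oB phis.
have dTs := smooth_base r (smooth_dt Ts).
have Vs : smooth W (fun j => (dt T (base j))^-1) by apply: smoothV => // j /Tt0.
elim: n => [|n IH] nr.
  exists (fun j => dt X (base j) / dt T (base j)); split.
  - by apply: smoothM => //; apply: smooth_base; exact: smooth_dt.
  - exact: (@depends_below_base K r B _ (fun p => dt X p / dt T p)).
  - move=> j Wj; rewrite /pro /= tau_dt // (Dt_base hr (f := X));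
    last exact: smooth_differentiable Xs _.
    rewrite expr1; move: (dx _ _) (dt X _) ((dt _ _)^-1) (xder 1 j) => a b c d; ring.
have [G [Gs dG pG]] := IH (ltnW nr).
pose l p := dx X p / dt T p ^+ n.+1.
have ls : smooth B l.
  apply: smoothM => //; first exact: smooth_dx.
  apply: smoothV => //; first by move=> p Bp; rewrite expf_neq0 ?Tt0.
  by apply: smoothX => //; exact: smooth_dt.
have lbs := smooth_base r ls.
have xs := smooth_xder n.+1 oW.
exists (fun j => (Dt (fun j => l (base j)) j * xder n.+1 j + Dt G j) / dt T (base j));
  split.
- apply: smoothM => //; apply: smoothD => //; last exact: smooth_Dt.
  by apply: smoothM => //; exact: smooth_Dt.
- apply: depends_belowM; last exact: (@depends_below_base K r B _ (fun p => (dt T p)^-1)).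
  apply: depends_belowD; last exact: depends_below_Dt.
  apply: depends_belowM; last by apply: depends_below_xder => //; exact: ltnW.
  have l3 : depends_below B 3 (Dt (fun j => l (base j))).
    by apply: depends_below_Dt => //; exact: (@depends_below_base K r B 2 l).
  exact: (depends_below_le _ l3).
- move=> j Wj; rewrite /pro iterS -/(pro phi n.+1) tau_dt //.
  rewrite (Dt_eq (G := fun j => l (base j) * xder n.+1 j + G j) oW) //.
  rewrite (DtD (smoothM oW lbs xs) Gs Wj) (DtM lbs xs Wj) Dt_xder //.
  by rewrite -addrA mulrDl /l [dt T _ ^+ n.+2]exprSr invfM; congr (_ + _);
    rewrite -!mulrA; congr (_ * (_ * _)); rewrite mulrC.
Qed.

(* Along the contact vector of a jet with x'' = 0, the base point moves on a line. *)
Lemma pro_second p y c : B p -> c 1%N = y -> c 2%N = 0 ->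
  pro phi 2 (mkjet r (p 0 0) (p 0 1) c) =
  'D_(row2 1 y) (fun q => 'D_(row2 1 y) X q / dt T q) p / dt T p.
Proof.
move=> Bp c1 c2; set j := mkjet _ _ _ _.
have bj : base j = p by rewrite base_mkjet // -row2_eta.
have Wj : W j by rewrite /= bj.
have x1 : xder 1 j = y by rewrite xder_mkjet // (leq_trans _ hr).
have x2 : xder 2 j = 0 by rewrite xder_mkjet // (leq_trans _ hr).
have bc : base (contact_vector j) = row2 1 y by rewrite base_contact // x1.
clearbody j; rewrite [LHS]/(Dt (pro phi 1) j / tau j) tau_dt // bj.
apply: (f_equal (fun z => z / dt T p)).
apply: derive_eq_along; near=> h.
have Wh : W (h *: contact_vector j + j) by near: h; exact: base_near.
have bh : base (h *: contact_vector j + j) = h *: row2 1 y + p.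
  by rewrite -bc -bj; apply/rowP => i; rewrite !mxE.
rewrite [LHS]/(Dt (fun j => X (base j)) _ / tau _) tau_dt // bh.
apply: (f_equal (fun z => z / dt T (h *: row2 1 y + p))).
rewrite /total_derivative [LHS](derive_comp_linear lsubmx X).
rewrite [X in 'D_X _ _](_ : _ = row2 1 y).
  by rewrite [X in 'D__ _ X](_ : _ = h *: row2 1 y + p) //; exact: bh.
rewrite [LHS]base_contact //; congr row2.
have i2 : (inord 2 : 'I_r.+2) = 2%N :> nat by rewrite inordK // !ltnS (leq_trans _ hr).
rewrite /xder !mxE i2 /= (leq_trans _ hr) // -/(xder 1 j) x1.
by rewrite x2 mulr0 add0r.
Unshelve. all: by end_near. Qed.

(* Jet coordinates with x' = y and x^(r) chosen so as to satisfy the equation. *)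
Definition solving (a : 'rV[K]_(r - 2)) (b y : K) (c : nat -> K) : nat -> K := fun m =>
  if m == 1%N then y else if m == r then b - \sum_(i < r - 2) a 0 i * c i.+2 else c m.

Lemma lhs_solving a b y c t x : arnold2_lhs a (mkjet r t x (solving a b y c)) = b.
Proof.
rewrite /arnold2_lhs xder_mkjet ?leqnn ?(leq_trans _ hr) // /solving eqxx.
have -> : (r == 1%N) = false by apply/eqP => r1; move: hr; rewrite r1.
rewrite -[RHS](subrK (\sum_(i < r - 2) a 0 i * c i.+2)); congr (_ + _).
apply: eq_bigr => i _; congr (_ * _).
have := ltn_ord i; rewrite ltn_subRL add2n => ir.
by rewrite xder_mkjet ?(ltnW ir) // (ltn_eqF ir).
Qed.

Lemma xder_solving a b y c t x m : (1 < m < r)%N ->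
  xder m (mkjet r t x (solving a b y c)) = c m.
Proof.
by move=> /andP[m1 mr]; rewrite xder_mkjet ?(ltnW m1) 1?ltnW // /solving (ltn_eqF mr)
  (gtn_eqF m1).
Qed.

(** Adding a multiple of it to the coefficients changes only the coefficient of x'', which jets with
    x'' = 0 cannot detect. *)
Definition unit_vector : 'rV[K]_(r - 2) := \row_i ((i : nat) == 0%N)%:R.

Lemma lhs_unit_vector a d j :
  arnold2_lhs (a + d *: unit_vector) j = arnold2_lhs a j + d * xder 2 j.
Proof.
have i0P : (0 < r - 2)%N by rewrite subn_gt0.
pose i0 := Ordinal i0P.
rewrite /arnold2_lhs -addrA; congr (_ + _).
rewrite [LHS](bigD1 i0) //= [X in _ = X + _](bigD1 i0) //= !mxE eqxx mulr1 mulrDl.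
rewrite addrAC; congr (_ + _); congr (_ + _); apply: eq_bigr => i ii0.
rewrite !mxE (_ : (i : nat) == 0%N = false) ?mulr0 ?addr0 //.
by apply: contraNF ii0 => /eqP h; apply/eqP/val_inj.
Qed.

Lemma pro_depends n : (n < r)%N -> depends_below (r := r) B n.+3 (pro phi n.+1).
Proof.
move=> nr; have [G [_ dG GE]] := pro_top nr.
have dl := @depends_below_base K r B n.+3 (fun p => dx X p / dt T p ^+ n.+1) isT.
have dx' : depends_below B n.+3 (@xder K r n.+1) by exact: depends_below_xder.
have dG' := depends_below_le (leqnSn n.+2) dG.
move=> j j' Wj Wj' jj; rewrite !GE // (dG' j j') //; congr (_ * _ + _).
  exact: dl.
exact: dx'.
Qed.

(** * Two equations differing in the coefficient of x'', mapped by the same transformation *)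

Section TwoEquations.
Variables (a a1 a2 : 'rV[K]_(r - 2)) (b b1 b2 d : K) (p : 'rV[K]_2).
Hypotheses (Bp : B p) (d0 : d != 0) (Xx0 : dx X p != 0).
Hypothesis h1 : forall j, base j = p ->
  arnold2_lhs a j = b <-> arnold2_lhs a1 (prolong phi j) = b1.
Hypothesis h2 : forall j, base j = p ->
  arnold2_lhs (a + d *: unit_vector) j = b <-> arnold2_lhs a2 (prolong phi j) = b2.

Let J y c := mkjet r (p 0 0) (p 0 1) (solving a b y c).

Let bJ y c : base (J y c) = p.
Proof. by rewrite base_mkjet // -row2_eta. Qed.

Let WJ y c : W (J y c). Proof. by rewrite /= bJ. Qed.

(** With x'' = 0 the jet satisfies both source equations; in the difference of the two images X^(r)
    cancels. *)
Let difference y c : c 2%N = 0 ->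
  \sum_(i < r - 2) (a2 - a1) 0 i * pro phi i.+2 (J y c) = b2 - b1.
Proof.
move=> c2; have E1 : arnold2_lhs a (J y c) = b by exact: lhs_solving.
have x2 : xder 2 (J y c) = 0 by rewrite xder_solving.
have E2 : arnold2_lhs (a + d *: unit_vector) (J y c) = b.
  by rewrite lhs_unit_vector E1 x2 mulr0 addr0.
have e1 := (h1 (bJ y c)).1 E1; have e2 := (h2 (bJ y c)).1 E2.
rewrite -e1 -e2 !arnold2_lhs_prolong opprD addrACA subrr add0r -sumrB.
by apply: eq_bigr => i _; rewrite !mxE mulrBl.
Qed.

(** Downward induction on [i]. Switching x^(i+2) from 0 to 1 leaves the lower X^(k) unchanged, the
    coefficients above [i] are already 0, and X^(i+2) changes by X_x / T_t^(i+2), which is nonzero;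
    i > 0 keeps x'' = 0. *)
Let higher_agree (i : 'I_(r - 2)) : (0 < i)%N -> (a2 - a1) 0 i = 0.
Proof.
move: {2}(r - 2 - i)%N (leqnn (r - 2 - i)) => n; elim: n i => [|n IH] i ni i_gt0.
  by have := ltn_ord i; rewrite -subn_gt0 ltnNge ni.
have := ltn_ord i; rewrite ltn_subRL add2n => ir.
pose c0 : nat -> K := fun=> 0.
pose c1 : nat -> K := fun m => (m == i.+2)%:R.
(* x^(i+2) sits at index i+3, so the two jets agree at all smaller indices. *)
have agree k (l : 'I_(2 + r)) : (k <= i.+3)%N -> (l < k)%N -> J 0 c1 0 l = J 0 c0 0 l.
  move=> ki lk; rewrite !mxE; case: ifP => // l0; case: ifP => // l1.
  rewrite /solving; case: ifP => // _; rewrite /c1 /c0.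
  have -> : (l.-1 == r) = false by apply/eqP; lia.
  by rewrite (_ : (_ == _) = false) //; apply/eqP; lia.
have D0 := @difference 0 c0 erefl.
have c12 : c1 2%N = 0 by rewrite /c1 eqSS eqSS eq_sym (gtn_eqF i_gt0).
have := @difference 0 c1 c12; rewrite -D0 => /eqP.
rewrite -subr_eq0 -sumrB (bigD1 i) //= big1 => [|k ki]; last first.
  rewrite -mulrBr; have [ik|] := ltnP i k.
    by rewrite IH ?mul0r //; lia.
  rewrite leq_eqVlt (inj_eq val_inj) (negbTE ki) /= => {}ki.
  have := ltn_ord k; rewrite ltn_subRL add2n => kr.
  rewrite (@pro_depends k.+1 _ (J 0 c1) (J 0 c0)) ?subrr ?mulr0 //; first exact: ltnW.
  by move=> l; apply: agree.
have [G [_ dG GE]] := @pro_top i.+1 (ltnW ir).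
rewrite !GE // (dG (J 0 c1) (J 0 c0)) //; last by move=> l; exact: agree.
rewrite !bJ !xder_solving // /c1 /c0 eqxx mulr0 mulr1 -mulrBr add0r addrK addr0.
by rewrite !mulf_eq0 invr_eq0 expf_eq0 (negbTE Xx0) (negbTE (Tt0 Bp)) !orbF => /eqP.
Qed.

Let leading_difference y c (i0 : 'I_(r - 2)) : i0 = 0%N :> nat -> c 2%N = 0 ->
  (a2 - a1) 0 i0 * pro phi 2 (J y c) = b2 - b1.
Proof.
move=> i00 c2; rewrite -(difference y c2) (bigD1 i0) //= i00 big1 ?addr0 // => k ki.
rewrite higher_agree ?mul0r // lt0n; apply: contra ki => /eqP h.
by apply/eqP/val_inj; exact: etrans h (esym i00).
Qed.

(** Otherwise both source equations would have the same image over [p], hence would be satisfied by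
    the same jets; a jet of the first one with x'' = 1 violates the second. *)
Lemma leading_distinct (i0 : 'I_(r - 2)) : i0 = 0%N :> nat -> (a2 - a1) 0 i0 != 0.
Proof.
move=> i00; apply/eqP => h.
have b12 : b1 = b2.
  have := @leading_difference 0 (fun=> 0) i0 i00 erefl.
  by rewrite h mul0r => /esym/eqP; rewrite subr_eq0 => /eqP.
have a12 : a1 = a2.
  apply/esym/eqP; rewrite -subr_eq0; apply/eqP/rowP => i; rewrite [RHS]mxE.
  have [i_gt0|] := ltnP 0 i; first exact: higher_agree.
  by rewrite leqn0 => /eqP hi; rewrite (_ : i = i0) //; apply: val_inj;
    exact: etrans hi (esym i00).
pose c : nat -> K := fun m => (m == 2)%:R.
have E1 : arnold2_lhs a (J 0 c) = b by exact: lhs_solving.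
have := (h1 (bJ 0 c)).1 E1; rewrite a12 b12 => /(h2 (bJ 0 c)).2.
rewrite lhs_unit_vector E1 xder_solving // /c eqxx mulr1 => /eqP.
by rewrite -subr_eq0 addrC addKr (negbTE d0).
Qed.

(** The right-hand side is free of y. When the target coefficients are values at T(p), it depends on
    [p] only through T(p), and so provides the [beta] of [lines_to_lines]. *)
Lemma second_derivative_on_lines y (i0 : 'I_(r - 2)) : i0 = 0%N :> nat ->
  'D_(row2 1 y) (fun q => 'D_(row2 1 y) X q / dt T q) p / dt T p =
  (b2 - b1) / (a2 - a1) 0 i0.
Proof.
move=> i00; rewrite -(@leading_difference y (fun=> 0) i0 i00 erefl).
rewrite mulrAC divff ?mul1r; last exact: leading_distinct.
rewrite /J -(pro_second (c := solving a b y (fun=> 0))) //.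
by rewrite /solving /= ltn_eqF.
Qed.

End TwoEquations.

End FiberPreserving.

(** * Symmetries of the trivial equation *)

Section AffinePreserving.
Variables (K : numFieldType) (r : nat).
Hypothesis hr : (3 <= r)%N.
Hypothesis flatK : flat_constant K.
Local Notation jet := 'rV[K]_(2 + r).
Implicit Types (j : jet) (F G : jet -> K).
Local Notation Dt := (@total_derivative K r).
Variables (B : set 'rV[K]_2) (phi : 'rV[K]_2 -> 'rV[K]_2).
Hypotheses (oB : open B) (phis : smooth B phi).
Hypothesis vB : vertically_convex B.
Local Notation W := (@base K r @^-1` B).
Local Notation T := (fun p => phi p 0 0).
Local Notation X := (fun p => phi p 0 1).
Local Notation tau := (Dt (@Tcomp K r phi)).
Hypothesis Tx0 : forall p, B p -> dx T p = 0.
Hypothesis Tt0 : forall p, B p -> dt T p != 0.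
Hypothesis Xi : xindep B (dx X).

Lemma depends_below_xindep n (f : 'rV[K]_2 -> K) : xindep B f ->
  depends_below B n.+1 (fun j : jet => f (base j)).
Proof. by move=> fi j j' Wj Wj' jj; apply: fi => //; rewrite !mxE jj. Qed.

Lemma Dt_xindep (f : 'rV[K]_2 -> K) j : smooth B f -> xindep B f -> W j ->
  Dt (fun j => f (base j)) j = dt f (base j).
Proof.
move=> fs fi Wj; rewrite (Dt_base hr); last exact: smooth_differentiable fs _.
by rewrite (dx_xindep oB fi Wj) mulr0 addr0.
Qed.

Definition top_coef n p := dx X p / dt T p ^+ n.
(** The coefficient of x^(n-1) in X^(n) when X_x depends on t alone: n copies of X_xt, and -(0 + 1 +
    ... + (n-1)) = -C(n, 2) copies of X_x T_tt from differentiating the powers 1 / T_t^k. *)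
Definition next_coef n p := n%:R * dt (dx X) p / dt T p ^+ n -
  'C(n, 2)%:R * dx X p * dt (dt T) p / dt T p ^+ n.+1.

Let Ts := smooth_T oB phis.
Let Xs := smooth_X oB phis.
Let dTs := smooth_dt Ts.
Let dXs := smooth_dx Xs.
Let dTi : xindep B (dt T) := xindep_derive oB _ (flat_xindep flatK vB Ts Tx0).

Lemma top_coefP n : smooth B (top_coef n) /\ xindep B (top_coef n).
Proof.
split.
  apply: smoothM => //; apply: smoothV => //; last exact: smoothX.
  by move=> p Bp; rewrite expf_neq0 ?Tt0.
by move=> p q Bp Bq pq; rewrite /top_coef (Xi Bp Bq pq) (dTi Bp Bq pq).
Qed.

Lemma next_coefP n : smooth B (next_coef n) /\ xindep B (next_coef n).
Proof.
have dXi : xindep B (dt (dx X)) by exact: xindep_derive.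
have ddTi : xindep B (dt (dt T)) by exact: xindep_derive.
have Vs m : smooth B (fun p => (dt T p ^+ m)^-1).
  apply: smoothV => //; last exact: smoothX.
  by move=> p Bp; rewrite expf_neq0 ?Tt0.
have cs (c : K) : smooth B (fun=> c) by exact: (smooth_cst (W := K)).
split; last first.
  by move=> p q Bp Bq pq; rewrite /next_coef (Xi Bp Bq pq) (dTi Bp Bq pq) (dXi _ _ Bp
    Bq pq) (ddTi _ _ Bp Bq pq).
have dds := smooth_dt dTs; have ddX := smooth_dt dXs.
exact: (smoothB oB (smoothM oB (smoothM oB (cs _) ddX) (Vs _))
  (smoothM oB (smoothM oB (smoothM oB (cs _) dXs) dds) (Vs _))).
Qed.

Lemma next_coefS n p : B p ->
  (dt (top_coef n) p + next_coef n p) / dt T p = next_coef n.+1 p.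
Proof.
move=> Bp; have t0 := Tt0 Bp.
have ts : smooth B (fun p => dt T p ^+ n) by exact: smoothX.
have -> : dt (top_coef n) p =
    dt (dx X) p / dt T p ^+ n - n%:R * dx X p * dt (dt T) p / dt T p ^+ n.+1.
  rewrite /top_coef (dtM (B := B) (g := fun p => (dt T p ^+ n)^-1)) //; last first.
    by apply: smoothV => // q Bq; rewrite expf_neq0 ?Tt0.
  rewrite {1}/dt deriveV ?expf_neq0 //; last exact: smooth_derivable ts Bp.
  have -> : 'D_(row2 1 0) (fun p => dt T p ^+ n) p = n%:R * dt T p ^+ n.-1 * dt (dt T) p.
    rewrite (_ : (fun p => dt T p ^+ n) = (dt T) ^+ n); last by rewrite exprfctE.
    rewrite [LHS](deriveX n); last exact: smooth_derivable dTs Bp.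
    by rewrite -[_ *: _]/(_ * _) -mulr_natl.
  rewrite -[_ *: _]/(_ * _).
  move: (dt T p) t0 (dx X p) (dt (dx X) p) (dt (dt T) p) => t t0 x dx' tt.
  case: n ts => [|n] _ /=; first by rewrite !mulr0n !mul0r; ring.
  have tn0 : t ^+ n != 0 by rewrite expf_neq0.
  rewrite !exprS expr0; move: (t ^+ n) tn0 => u u0; set c := n.+1%:R.
  by field; rewrite u0 t0.
rewrite /next_coef binS bin1 natrD -natr1.
move: (dt T p) t0 (dx X p) (dt (dx X) p) (dt (dt T) p) => t t0 x dx' tt.
have tn0 : t ^+ n != 0 by rewrite expf_neq0.
rewrite !exprS; move: (t ^+ n) tn0 => u u0; set c := n%:R; set d := 'C(n, 2)%:R.
by field; rewrite u0 t0.
Qed.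

(** The two leading coefficients depend on t alone, so D_t of them contributes no x' and they obey a
    closed recursion. The remainder reads indices up to n, hence nothing beyond x^(n-1). *)
Lemma pro_affine n : (n < r)%N -> exists G, [/\ smooth W G, depends_below B n.+1 G &
  forall j, W j -> pro phi n.+1 j = top_coef n.+1 (base j) * xder n.+1 j +
    next_coef n.+1 (base j) * xder n j + G j].
Proof.
have oW := open_base (r := r) oB.
have Vs : smooth B (fun p => (dt T p)^-1) by exact: smoothV.
have Vi : xindep B (fun p => (dt T p)^-1) by move=> p q Bp Bq pq; rewrite (dTi Bp Bq pq).
elim: n => [|n IH] nr.
  have xs : smooth B (fun p : 'rV[K]_2 => p 0 1) by exact: smooth_coord_fun.
  (* X is affine in x, so X_t - x X_xt depends on t alone. *)
  pose g p := dt X p - p 0 1 * dt (dx X) p.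
  have ddX := smooth_dt dXs.
  have xd : smooth B (fun p => p 0 1 * dt (dx X) p) by exact: smoothM.
  have gs : smooth B g by apply: smoothB => //; exact: smooth_dt.
  have gi : xindep B g.
    apply: (flat_xindep flatK vB gs) => p Bp; rewrite /g {1}/dx [LHS]deriveB; last first.
    - exact: smooth_derivable xd Bp.
    - exact: smooth_derivable (smooth_dt Xs) Bp.
    rewrite -/(dx (dt X) p) (dx_dt flatK oB vB Xs dXs Xi _ Bp) //.
    rewrite -/(dx (fun p => p 0 1 * dt (dx X) p) p) (dxM xs ddX Bp).
    rewrite (dx_xindep oB (xindep_derive oB (row2 1 0) Xi) Bp) mulr0 add0r.
    by rewrite [dx _ p]derive_coord_fun row2E1 mul1r subrr.
  exists (fun j => g (base j) / dt T (base j)); split.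
  - by apply: (@smooth_base K r B (fun p => g p / dt T p)); exact: smoothM.
  - apply: depends_belowM; first exact: depends_below_xindep gi.
    exact: (@depends_below_xindep 0 (fun p => (dt T p)^-1) Vi).
  - move=> j Wj; rewrite [LHS]/(Dt (fun j => X (base j)) j / tau j).
    rewrite (tau_dt hr oB phis Tx0) // (Dt_base hr (f := X));
      last exact: smooth_differentiable Xs _.
    rewrite xder0 /g /top_coef /next_coef expr1 mul1r.
    have -> : 'C(1, 2)%:R = 0 :> K by [].
    rewrite !mul0r subr0.
    move: (dx X _) (dt X _) (dt (dx X) _) ((dt _ _)^-1) (xder 1 j) (base j 0 1) =>
      a b c d e f.
    by rewrite -[LHS]/((b + e * a) * d); ring.
have [G [Gs dG pG]] := IH (ltnW nr).
have [ls li] := top_coefP n.+1; have [ms mi] := next_coefP n.+1.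
have lbs := smooth_base r ls; have mbs := smooth_base r ms.
have xs := smooth_xder n oW; have xs' := smooth_xder n.+1 oW.
exists (fun j => (dt (next_coef n.+1) (base j) * xder n j + Dt G j) / dt T (base j));
  split.
- apply: smoothM => //; last exact: (smooth_base r Vs).
  apply: smoothD => //; last exact: smooth_Dt.
  by apply: smoothM => //; exact/(smooth_base r)/smooth_dt.
- apply: depends_belowM; last exact: (@depends_below_xindep n.+1 (fun p =>
  (dt T p)^-1) Vi).
  apply: depends_belowD; last exact: depends_below_Dt.
  apply: depends_belowM; last by apply: depends_below_xder => //; exact: ltnW (ltnW nr).
  by apply: (@depends_below_xindep n.+1 (dt (next_coef n.+1))); exact: xindep_derive.
- move=> j Wj; rewrite [LHS]/(Dt (pro phi n.+1) j / tau j) (tau_dt hr oB phis Tx0) //.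
  rewrite (Dt_eq (G := fun j => top_coef n.+1 (base j) * xder n.+1 j +
      next_coef n.+1 (base j) * xder n j + G j) oW) //.
  rewrite (DtD (smoothD oW (smoothM oW lbs xs') (smoothM oW mbs xs)) Gs Wj).
  rewrite (DtD (smoothM oW lbs xs') (smoothM oW mbs xs) Wj).
  rewrite (DtM lbs xs' Wj) (DtM mbs xs Wj) !Dt_xder // ?(ltnW nr) //.
  rewrite (Dt_xindep ls li Wj) (Dt_xindep ms mi Wj) -(next_coefS n.+1 Wj).
  have -> : top_coef n.+2 (base j) = top_coef n.+1 (base j) / dt T (base j).
    by rewrite /top_coef [dt T _ ^+ n.+2]exprSr invfM mulrA.
  move: (top_coef _ _) (next_coef _ _) (dt (top_coef _) _) (dt (next_coef _) _) ((dt T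
    _)^-1) (Dt G j) (xder n j) (xder n.+1 j) (xder n.+2 j) => a b c d e f g h i.
  rewrite -[LHS]/((a * i + c * h + (b * h + d * g) + f) * e).
  by ring.
Qed.

(* Compares the coefficients of x^(r-1) in X^(r) = 0. *)
Lemma symmetry_multiplier p : B p ->
  (forall j, base j = p -> xder r j = 0 -> xder r (prolong phi j) = 0) ->
  2 * dt (dx X) p * dt T p = r.-1%:R * dx X p * dt (dt T) p.
Proof.
move=> Bp sym.
have r0 : (0 < r)%N by rewrite (leq_trans _ hr).
have rE : r.-1.+1 = r by rewrite prednK.
have nr : (r.-1 < r)%N by rewrite rE.
have [G [_]] := @pro_affine r.-1 nr; rewrite rE => dG GE.
pose J (c : K) : jet := mkjet r (p 0 0) (p 0 1) (fun m => if m == r.-1 then c else 0).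
have bJ c : base (J c) = p by rewrite base_mkjet // -row2_eta.
have WJ c : W (J c) by rewrite /= bJ.
have xr c : xder r (J c) = 0 by rewrite xder_mkjet ?leqnn ?r0 // (gtn_eqF nr).
have xr1 c : xder r.-1 (J c) = c by rewrite xder_mkjet ?eqxx //; lia.
have E c : next_coef r p * c + G (J c) = 0.
  have := sym (J c) (bJ c) (xr c); rewrite xder_prolong // GE // bJ.
  by rewrite xr xr1 mulr0 add0r.
(* x^(r-1) has index r, just outside what [G] reads. *)
have G01 : G (J 1) = G (J 0).
  apply: dG => // i ir; rewrite !mxE; case: ifP => // i0; case: ifP => // i1.
  by rewrite (_ : (_ == _) = false) //; apply/eqP; lia.
have := E 0; have := E 1; rewrite G01 mulr0 add0r => + g0; rewrite g0 mulr1 addr0.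
have t0 := Tt0 Bp; rewrite /next_coef => /eqP.
rewrite subr_eq0 => /eqP.
have bin : 2 * 'C(r, 2)%:R = r%:R * r.-1%:R :> K.
  by rewrite -!natrM -(mul_bin_diag r 1) bin1.
have R0 : (r%:R : K) != 0 by rewrite pnatr_eq0 -lt0n.
move: bin R0; rewrite exprS; have := expf_neq0 r t0.
move: (dt T p) t0 (dx X p) (dt (dx X) p) (dt (dt T) p) => t t0 w w' s.
move: (t ^+ r) (r%:R : K) ('C(r, 2)%:R : K) (r.-1%:R : K) => u R C Q u0 bin R0 h.
apply: (mulfI R0); transitivity (2 * t * u * (R * w' / u)); first by field.
rewrite h; transitivity (2 * C * w * s); first by field; rewrite u0 t0.
by rewrite bin; ring.
Qed.

End AffinePreserving.

(** * The contradiction *)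

Lemma derive_comp_plane (K : numFieldType) (f : 'rV[K]_2 -> K) (s : 'rV[K]_2 ->
  'rV[K]_2) p v :
  differentiable s p -> differentiable f (s p) ->
  'D_v (fun q => f (s q)) p =
  dt f (s p) * 'D_v (fun q => s q 0 0) p + dx f (s p) * 'D_v (fun q => s q 0 1) p.
Proof.
move=> sd fd; rewrite !derive_coord // mulrC [X in _ + X]mulrC.
rewrite -derive_row2 // -row2_eta.
rewrite deriveE; last exact: (@differentiable_comp _ _ _ _ s f).
have /= -> := diff_comp sd fd.
by rewrite !deriveE.
Qed.

(* The unknowns are the values, at a point p and at sigma p, of s = S_t, s2 = S_tt,
   w = Y_x, w1 = Y_xt for sigma = (S, Y), and of p1 = P_t, p2 = P_tt, k = Q_x / P_t,
   k1 = k_t for phi = (P, Q).  The second conclusion excludes the t-derivative of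
   the first one. *)
Lemma incompatible_multipliers (K : numFieldType) (m : nat) (t s s2 k k1 p1 p2 w w1 : K) :
  (0 < m)%N -> t != 0 -> k != 0 -> p1 * s = 2 * t -> p2 * s ^+ 2 + p1 * s2 = 2 -> k *
    p1 * w = 1 ->
  k1 * s * p1 * w + k * p2 * s * w + k * p1 * w1 = 0 -> p2 * k = - 2 * p1 * k1 ->
  2 * w1 * s = m.+1%:R * w * s2 ->
  (m.+1%:R * k + 2 * m%:R * (t * (k1 * s)) = 0) /\
  (m.+1%:R * (k1 * s) + 2 * m%:R * (k1 * s + t * (k1 * s2)) = 0 -> False).
Proof.
move=> m_gt0 t0 k0 e1 e2 e3 e4 e5 e6.
have two0 : (2 : K) != 0 by rewrite pnatr_eq0.
have p10 : p1 != 0 by apply: contra_eq_neq e3 => ->; rewrite mulr0 mul0r eq_sym oner_eq0.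
have s0 : s != 0.
  by apply/eqP => s0; move/eqP: e1;
    rewrite s0 mulr0 eq_sym mulf_eq0 (negbTE two0) (negbTE t0).
have w0 : w != 0 by apply: contra_eq_neq e3 => ->; rewrite mulr0 eq_sym oner_eq0.
rewrite -natr1; set M := m%:R; set M1 := M + 1.
have e6' : 2 * w1 * s = M1 * w * s2 by rewrite e6 -natr1.
have M10 : M1 != 0 by rewrite /M1 /M natr1 pnatr_eq0.
(* [f1], [f2], [f3] and [f5] are the pointwise forms of: Y_x is proportional to k(S), k(S)^2 to
   (S')^(m+1), k(S) to t^(-(m+1)/(2m)), and S' to t^(-1/m). *)
have f1 : k * w1 = k1 * s * w.
  apply: (mulfI p10); apply/eqP; rewrite -subr_eq0 -e4; apply/eqP.
  transitivity (p1 * (k * w1) - p1 * (k1 * s * w) + 0 * (s * w)); first by ring.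
  rewrite (_ : 0 = p2 * k - (- 2 * p1 * k1)); first by ring.
  by rewrite e5 subrr.
have f2 : 2 * k1 * s ^+ 2 = M1 * k * s2.
  apply: (mulfI w0); transitivity (2 * s * (k1 * s * w)); first by ring.
  by rewrite -f1; transitivity (k * (2 * w1 * s)); [ring|rewrite e6'; ring].
have f3 : M1 * k + 2 * M * (t * (k1 * s)) = 0.
  apply: (mulfI two0); rewrite mulr0.
  transitivity (M1 * k * 2 + 2 * M * (2 * t) * (k1 * s)); first by ring.
  rewrite -{1}e2 -e1.
  transitivity (M1 * s ^+ 2 * (p2 * k) + p1 * (M1 * k * s2) + 2 * M * p1 * k1 * s ^+
    2); first by ring.
  by rewrite e5 -f2 /M1; ring.
split=> // f4.
have k10 : k1 != 0.
  apply/eqP => k10; move/eqP: f3; rewrite k10 mul0r !mulr0 addr0 mulf_eq0.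
  by rewrite (negbTE M10) (negbTE k0).
have f5 : 2 * M * (t * s2) = - 2 * s.
  apply: (mulfI k0); apply: (mulfI M10).
  transitivity (2 * M * t * (M1 * k * s2)); first by ring.
  rewrite -f2; transitivity (2 * s * (2 * M * (t * (k1 * s)))); first by ring.
  by rewrite (_ : 2 * M * _ = - (M1 * k)); [ring|apply/eqP; rewrite -addr_eq0 addrC f3].
(* Once [f5] removes [s2], the left side of [f4] is [k1] times this product; 3 m = 1 has no solution
   in natural numbers. *)
have : s * (3 * M - 1) = 0.
  apply: (mulfI k10); rewrite mulr0 -f4.
  transitivity (k1 * (M1 * s + 2 * M * s - 2 * s)); first by rewrite /M1; ring.
  by transitivity (M1 * (k1 * s) + 2 * M * (k1 * s) + k1 * (- 2 * s));
    [ring|rewrite -f5; ring].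
move/eqP; rewrite mulf_eq0 (negbTE s0) /= subr_eq0 /M -natrM pnatr_eq1.
by move=> /eqP; lia.
Qed.

Section Incompatibility.
Variables (K : numFieldType) (r : nat).
Hypothesis hr : (3 <= r)%N.
Hypothesis flatK : flat_constant K.

Variables (B V : set 'rV[K]_2) (phi sigma : 'rV[K]_2 -> 'rV[K]_2).
Hypotheses (oB : open B) (phis : smooth B phi) (vB : vertically_convex B).
Hypotheses (oV : open V) (sigmas : smooth V sigma) (vV : vertically_convex V).
Hypothesis V0 : V !=set0.
Hypothesis Vt0 : forall p, V p -> p 0 0 != 0.
Hypothesis sV : forall p, V p -> B (sigma p).
Hypothesis factor : forall p, V p -> phi (sigma p) = row2 (p 0 0 ^+ 2) (p 0 1).
Hypothesis sym : forall j : 'rV[K]_(2 + r), V (base j) -> prolong_dom sigma j ->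
  xder r j = 0 -> xder r (prolong sigma j) = 0.
Local Notation P := (fun p => phi p 0 0).
Local Notation Q := (fun p => phi p 0 1).
Local Notation S := (fun p => sigma p 0 0).
Local Notation Y := (fun p => sigma p 0 1).
Local Notation k := (fun p => dx Q p / dt P p).
Hypothesis Pt0 : forall p, B p -> dt P p != 0.
Hypothesis Px0 : forall p, B p -> dx P p = 0.
Hypothesis Pi : xindep B P.
Hypothesis ki : xindep B k.
Hypothesis kk : forall p, B p ->
  dt (dt k) p = 0 /\ dt (dt P) p * k p = - 2 * dt P p * dt k p.

Lemma no_factorization : False.
Proof.
have Ps := smooth_T oB phis; have Qs := smooth_X oB phis.
have Ss := smooth_T oV sigmas; have Ys := smooth_X oV sigmas.
have dPs := smooth_dt Ps.
have ks : smooth B k.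
  by apply: (smoothM oB (smooth_dx Qs)); exact: smoothV.
have dPi : xindep B (dt P) by exact: xindep_derive.
have dki : xindep B (dt k) by exact: xindep_derive.
have sd p : V p -> differentiable sigma p by exact: smooth_differentiable.
have chain f p v : smooth B f -> V p -> 'D_v (fun q => f (sigma q)) p =
    dt f (sigma p) * 'D_v S p + dx f (sigma p) * 'D_v Y p.
  by move=> fs Vp; apply: derive_comp_plane;
    [exact: sd|exact: smooth_differentiable fs (sV Vp)].
have chaini f p : smooth B f -> xindep B f -> V p ->
    dt (fun q => f (sigma q)) p = dt f (sigma p) * dt S p.
  by move=> fs fi Vp; rewrite {1}/dt chain // (dx_xindep oB fi (sV Vp)) mul0r addr0.
have Ssq p v : V p -> dt P (sigma p) * 'D_v S p = 2 * p 0 0 * v 0 0.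
  move=> Vp; have := chain P p v Ps Vp; rewrite Px0 ?mul0r ?addr0 => [<-|];
    last exact: sV.
  rewrite (derive_eqB (g := fun q => q 0 0 * q 0 0) oV _ _ Vp); last first.
    by move=> q Vq; rewrite factor // row2E0 expr2.
  rewrite [LHS]deriveM; [|exact: derivable_coord_fun|exact: derivable_coord_fun].
  by rewrite derive_coord_fun -[_ *: _]/(p 0 0 * v 0 0); ring.
have Sx0 p : V p -> dx S p = 0.
  move=> Vp; apply: (mulfI (Pt0 (sV Vp))); rewrite [LHS]Ssq // row2E0 mulr0.
  by rewrite mulr0.
have St p : V p -> dt P (sigma p) * dt S p = 2 * p 0 0.
  by move=> Vp; rewrite [LHS]Ssq // row2E0 mulr1.
have two0 : (2 : K) != 0 by rewrite pnatr_eq0.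
have St0 p : V p -> dt S p != 0.
  move=> Vp; apply/eqP => h; have /eqP := St p Vp.
  by rewrite h mulr0 eq_sym mulf_eq0 (negbTE two0) (negbTE (Vt0 Vp)).
have Si : xindep V S by exact: flat_xindep.
(* The x-derivative of Q(S, Y) = x, with Q_x written as k P_t. *)
have QY p : V p -> k (sigma p) * dt P (sigma p) * dx Y p = 1.
  move=> Vp; have := chain Q p (row2 0 1) Qs Vp.
  rewrite -/(dx S p) Sx0 // mulr0 add0r -/(dx Y p) divfK; last exact/Pt0/sV.
  move=> <-.
  rewrite (derive_eqB (g := fun q => q 0 1) oV _ _ Vp); last first.
    by move=> q Vq; rewrite factor // row2E1.
  by rewrite derive_coord_fun row2E1.
have kn0 p : V p -> k (sigma p) != 0.
  by move=> Vp; apply: contra_eq_neq (QY p Vp) => ->; rewrite !mul0r eq_sym oner_eq0.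
(* By [QY], Y_x is the inverse of k P_t at sigma, a function of t alone; thus sigma is affine in x,
   as [symmetry_multiplier] requires. *)
have Yi : xindep V (dx Y).
  move=> p q Vp Vq pq; have kP0 : k (sigma p) * dt P (sigma p) != 0.
    by apply: mulf_neq0; [exact: kn0|exact/Pt0/sV].
  apply: (mulfI kP0); rewrite QY // -(QY q Vq).
  have Spq := Si p q Vp Vq pq.
  by rewrite (ki (sV Vp) (sV Vq) Spq) (dPi _ _ (sV Vp) (sV Vq) Spq).
have comp_d (f : 'rV[K]_2 -> K) p v : smooth B f -> V p -> derivable (fun q =>
  f (sigma q)) p v.
  move=> fs Vp; apply: diff_derivable; apply: (@differentiable_comp _ _ _ _ sigma f);
    first exact: sd.
  exact: smooth_differentiable fs (sV Vp).
have dS_d p v : V p -> derivable (dt S) p v by exact: smooth_derivable (smooth_dt Ss).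
have dY_d p v : V p -> derivable (dx Y) p v by exact: smooth_derivable (smooth_dx Ys).
have dtM' (f g : 'rV[K]_2 -> K) p : derivable f p (row2 1 0) -> derivable g p (row2 1
  0) ->
    dt (fun q => f q * g q) p = f p * dt g p + dt f p * g p.
  by move=> fd gd; rewrite {1}/dt [LHS]deriveM //; congr (_ + _); exact: mulrC.
(* [E2] and [E4] are the t-derivatives of [St] and [QY]. *)
have E2 p : V p -> dt (dt P) (sigma p) * dt S p ^+ 2 + dt P (sigma p) * dt (dt S) p = 2.
  move=> Vp; transitivity (dt (fun q => 2 * q 0 0) p); last first.
    by rewrite /dt deriveMl ?derive_coord_fun ?row2E0 ?mulr1 //;
      exact: derivable_coord_fun.
  rewrite [RHS](derive_eqB (g := fun q => dt P (sigma q) * dt S q) oV _ _ Vp); last first.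
    by move=> q Vq; rewrite St.
  rewrite [RHS]dtM'; [|exact: comp_d|exact: dS_d].
  by rewrite (chaini (dt P)) // addrC expr2 mulrA.
have E4 p : V p -> dt k (sigma p) * dt S p * dt P (sigma p) * dx Y p +
    k (sigma p) * dt (dt P) (sigma p) * dt S p * dx Y p +
    k (sigma p) * dt P (sigma p) * dt (dx Y) p = 0.
  move=> Vp; transitivity (dt (fun=> 1 : K) p); last exact: derive_cst.
  rewrite [RHS](derive_eqB (g := fun q =>
    k (sigma q) * dt P (sigma q) * dx Y q) oV _ _ Vp); last first.
    by move=> q Vq; rewrite QY.
  have k_d := comp_d k p (row2 1 0) ks Vp.
  have dP_d := comp_d (dt P) p (row2 1 0) dPs Vp.
  rewrite [RHS]dtM'; [|exact: (@derivableM _ _ _ _ _ _ k_d dP_d)|exact: dY_d].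
  rewrite (dtM' _ _ _ k_d dP_d).
  rewrite (chaini (dt P)) // (chaini k) //.
  move: (k (sigma p)) (dt k _) (dt P _) (dt (dt P) _) (dt S p) (dx Y p) (dt (dx Y) p)
    => a b c d e f g.
  by ring.
have rE : (r - 2).+1 = r.-1 by lia.
have m_gt0 : (0 < r - 2)%N by rewrite subn_gt0.
have E6 p : V p -> 2 * dt (dx Y) p * dt S p = (r - 2).+1%:R * dx Y p * dt (dt S) p.
  move=> Vp; rewrite rE; have := symmetry_multiplier hr flatK oV sigmas vV Sx0 St0 Yi Vp.
  apply=> j jp; apply: sym; first by rewrite jp.
  by rewrite /prolong_dom /= (tau_dt hr oV sigmas Sx0) /= ?jp // St0.
have main p : V p -> ((r - 2).+1%:R * k (sigma p) + 2 * (r - 2)%:R * (p 0 0 * (dt k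
  (sigma p) * dt S p)) = 0) /\
  ((r - 2).+1%:R * (dt k (sigma p) * dt S p) + 2 * (r - 2)%:R * (dt k (sigma p) * dt S
    p + p 0 0 * (dt k (sigma p) * dt (dt S) p)) = 0 -> False).
  move=> Vp; exact: (incompatible_multipliers m_gt0 (Vt0 Vp) (kn0 p Vp) (St p Vp) (E2 p
    Vp) (QY p Vp) (E4 p Vp)
    (kk (sV Vp)).2 (E6 p Vp)).
have [p Vp] := V0; have [_] := main p Vp; apply.
(* The first identity of [main] holds throughout [V], so it can be differentiated in t; its k_tt
   term vanishes by [kk]. *)
transitivity (dt (fun=> 0 : K) p); last exact: derive_cst.
rewrite [RHS](derive_eqB (g := fun q : 'rV[K]_2 => (r - 2).+1%:R * k (sigma q) +
  2 * (r - 2)%:R * (q 0 0 * (dt k (sigma q) * dt S q))) oV _ _ Vp); last first.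
  by move=> q Vq; rewrite (main q Vq).1.
have t_d : derivable (fun q : 'rV[K]_2 =>
  q 0 0) p (row2 1 0) by exact: derivable_coord_fun.
have dks := smooth_dt ks.
have k_d := comp_d k p (row2 1 0) ks Vp.
have l_d := comp_d (dt k) p (row2 1 0) dks Vp.
have lS_d : derivable (fun q => dt k (sigma q) * dt S q) p (row2 1 0).
  exact: (@derivableM _ _ _ _ _ _ l_d (dS_d p _ Vp)).
have tlS_d : derivable (fun q : 'rV[K]_2 =>
  q 0 0 * (dt k (sigma q) * dt S q)) p (row2 1 0).
  exact: (@derivableM _ _ _ _ _ _ t_d lS_d).
have D1 (c : K) : 'D_(row2 1 0) (fun q =>
  c * k (sigma q)) p = c * (dt k (sigma p) * dt S p).
  rewrite [LHS]deriveMl; last exact: k_d.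
  exact: (congr1 (fun z => c * z) (chaini k p ks ki Vp)).
have D2 (c : K) : 'D_(row2 1 0) (fun q : 'rV[K]_2 =>
  c * (q 0 0 * (dt k (sigma q) * dt S q))) p =
    c * (dt k (sigma p) * dt S p + p 0 0 * (dt k (sigma p) * dt (dt S) p)).
  rewrite [LHS]deriveMl; last exact: tlS_d.
  apply: (congr1 (fun z => c * z)).
  rewrite [LHS](dtM' _ _ _ t_d lS_d) [X in p 0 0 * X](dtM' _ _ _ l_d (dS_d p _ Vp)).
  rewrite (chaini (dt k)) // (kk (sV Vp)).1 !mul0r addr0 addrC.
  by rewrite [dt _ p]derive_coord_fun row2E0 mul1r.
have c_d (c : K) : derivable (fun=> c) p (row2 1 0) by exact: derivable_cst.
rewrite [RHS]deriveD; [|exact: (@derivableM _ _ _ _ _ _ (c_d _) k_d)|exact: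
  (@derivableM _ _ _ _ _ _ (c_d _) tlS_d)].
by rewrite D1 D2.
Qed.

End Incompatibility.

(** * The admissible transformation *)

Section SquareTime.
Variables (K : numFieldType) (r : nat).
Hypothesis hr : (3 <= r)%N.
Local Notation jet := 'rV[K]_(2 + r).
Implicit Types (j : jet).
Local Notation Dt := (@total_derivative K r).

Definition square_time (p : 'rV[K]_2) : 'rV[K]_2 := row2 (p 0 0 ^+ 2) (p 0 1).

Definition nonzero_time : set 'rV[K]_2 := [set p | p 0 0 != 0].

(* Coefficients of (2t)^n (d/dt)^n in terms of the (2t)^(2k) (d/ds)^k, s = t^2. *)
Fixpoint square_coef (n k : nat) : K :=
  if n is n'.+1 then ((4 * k)%:R - (2 * n')%:R) * square_coef n' k +
    (if k is k'.+1 then square_coef n' k' else 0)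
  else (k == 0%N)%:R.

Lemma square_coef_above n k : (n < k)%N -> square_coef n k = 0.
Proof.
elim: n k => [|n IH] [|k] //= nk.
by rewrite !IH ?mulr0 ?addr0 // ltnW.
Qed.

Lemma square_coef_diag n : square_coef n n = 1.
Proof. by elim: n => [//|n IH] /=; rewrite square_coef_above // mulr0 add0r. Qed.

Lemma square_coefS n k : square_coef n.+1 k =
  ((4 * k)%:R - (2 * n)%:R) * square_coef n k + (if k is k'.+1 then square_coef n k'
    else 0).
Proof. by []. Qed.

Lemma square_coef0 n : square_coef n.+1 0 = 0.
Proof.
elim: n => [|n IH]; last by rewrite square_coefS IH mulr0 add0r.
by rewrite square_coefS !muln0 subrr mul0r add0r.
Qed.

(** The d/ds term of (d/dt)^n carries the n-th derivative of s = t^2, which vanishes for n >= 3.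
    This keeps x' out of the target equation. *)
Lemma square_coef1 n : square_coef n.+3 1 = 0.
Proof.
elim: n => [|n IH]; last by rewrite square_coefS IH square_coef0 mulr0 add0r.
by rewrite square_coefS square_coef0 subrr mul0r add0r.
Qed.

(** With q = 2t, the operator q D_t sends y_k = q^(2k) X^(k) to 4k y_k + y_(k+1), and q^n x^(n) to
    2n q^n x^(n) + q^(n+1) x^(n+1); the recursion of [square_coef] balances the two. *)
Lemma square_coef_sum n (y : nat -> K) :
  \sum_(k < n.+2) square_coef n.+1 k * y k =
  \sum_(k < n.+1) square_coef n k * ((4 * k)%:R * y k + y k.+1) -
  (2 * n)%:R * \sum_(k < n.+1) square_coef n k * y k.
Proof.
under eq_bigr do rewrite /= mulrDl.
rewrite big_split /= [X in X + _]big_ord_recr /= square_coef_above // mulr0 mul0r addr0.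
rewrite [X in _ + X]big_ord_recl /= mul0r add0r mulr_sumr -sumrB -big_split /=.
by apply: eq_bigr => k _; ring.
Qed.

Lemma open_nonzero_time : open nonzero_time.
Proof.
rewrite (_ : nonzero_time = [set p | setT p /\ p 0 0 != 0]).
  by apply: open_nonzero; [exact: openT|exact/smooth_coord_fun/openT].
by apply/seteqP; split=> p //= [].
Qed.

Let T (p : 'rV[K]_2) : K := square_time p 0 0.
Let X (p : 'rV[K]_2) : K := square_time p 0 1.

Lemma square_timeE0 : T = fun p => p 0 0 * p 0 0.
Proof. by apply/funext => p; rewrite /T row2E0 expr2. Qed.

Lemma square_timeE1 : X = fun p => p 0 1.
Proof. by apply/funext => p; rewrite /X row2E1. Qed.

Lemma smooth_square_time D : open D -> smooth D square_time.
Proof.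
move=> oD; apply: smooth_row => // i.
have ts : smooth D (fun p : 'rV[K]_2 => p 0 0) by exact: smooth_coord_fun.
have [-> | ->] : i = 0 \/ i = 1.
- by case: i => [[|[|//]] h]; [left|right]; exact: val_inj.
- by rewrite -/T square_timeE0; exact: smoothM.
- by rewrite -/X square_timeE1; exact: smooth_coord_fun.
Qed.

Lemma derive_square_time p v : 'D_v T p = 2 * p 0 0 * v 0 0.
Proof.
rewrite square_timeE0 [LHS]deriveM;
  [|exact: derivable_coord_fun|exact: derivable_coord_fun].
by rewrite derive_coord_fun -[_ *: _]/(p 0 0 * v 0 0); ring.
Qed.

Lemma point_transformation_square_time : point_transformation nonzero_time square_time.
Proof.
have oU := open_nonzero_time.
split=> //; first by exists (row2 1 0); rewrite /nonzero_time /= row2E0 oner_eq0.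
  exact: smooth_square_time.
move=> p p0; rewrite det_jacobian2;
  last exact: smooth_differentiable (smooth_square_time oU) p0.
rewrite -/T -/X /dt /dx !derive_square_time square_timeE1 !derive_coord_fun !row2E0
  !row2E1.
by rewrite mul0r subr0 !mulr1 mulf_neq0 // pnatr_eq0.
Qed.

Lemma tau_square_time j : Dt (@Tcomp K r square_time) j = 2 * base j 0 0.
Proof.
rewrite [LHS](Dt_base hr (f := T)); last first.
  by apply: smooth_differentiable (smooth_coord 0 openT (smooth_square_time openT)) _.
by rewrite /dt /dx !derive_square_time !row2E0 !mulr0 addr0 mulr1.
Qed.

(** Induction by applying (2t) D_t, starting from x = X. Source derivatives are expressed through
    target ones, the direction needed to transform x^(r) = 0. *)
Lemma jet_expansion n j : (n <= r)%N -> nonzero_time (base j) ->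
  (2 * base j 0 0) ^+ n * xder n j =
  \sum_(k < n.+1) square_coef n k * ((2 * base j 0 0) ^+ (2 * k) * pro square_time k j).
Proof.
have oU := open_nonzero_time.
have oW := open_base (r := r) oU.
pose W := @base K r @^-1` nonzero_time.
have two0 : (2 : K) != 0 by rewrite pnatr_eq0.
pose q j := 2 * base j 0 0.
have q0 j' : W j' -> q j' != 0 by move=> Wj; rewrite mulf_neq0.
have qs : smooth W q.
  apply: (@smooth_base K r nonzero_time (fun p => 2 * p 0 0)).
  by apply: smoothM => //; [exact: (smooth_cst (W := K))|exact: smooth_coord_fun].
have Dq j' : Dt q j' = 2.
  rewrite [LHS](Dt_base hr (f := fun p => 2 * p 0 0)); last first.
    by apply: differentiableM => //; exact: differentiable_coord.
  rewrite /dt /dx !deriveMl ?derive_coord_fun;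
    [|exact: derivable_coord_fun|exact: derivable_coord_fun].
  by rewrite !row2E0 !mulr0 addr0 mulr1.
have ps k : smooth W (@pro K r square_time k).
  apply: (smooth_subset _ (smooth_pro r oU (smooth_square_time oU) k)).
  by move=> j' Wj'; split => //; rewrite tau_square_time mulf_neq0.
have Dp k j' : W j' -> Dt (pro square_time k) j' = q j' * pro square_time k.+1 j'.
  move=> Wj'; rewrite [pro square_time k.+1 _]/(Dt (pro square_time k) j' / _).
  by rewrite tau_square_time mulrC divfK // q0.
have qX m : smooth W (fun j => q j ^+ m) by exact: smoothX.
elim: n j => [|n IH] j nr Wj.
  by rewrite big_ord1 /= muln0 !expr0 !mul1r xder0 -[RHS]/(X (base j)) square_timeE1.
have := Dt_eq (G := fun j => \sum_(k < n.+1) square_coef n k * (q j ^+ (2 * k) * pro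
  square_time k j)) oW
  (fun j' Wj' => IH j' (ltnW nr) Wj') Wj.
rewrite -/(q j).
have xs := smooth_xder n oW.
have pow m : m%:R * q j ^+ m.-1 * q j = m%:R * q j ^+ m.
  by case: m => [|m]; [rewrite !mul0r|rewrite -mulrA -exprSr].
have DqX m : q j * Dt (fun j => q j ^+ m) j = (2 * m)%:R * q j ^+ m.
  by rewrite (DtX m qs Wj) Dq mulrC mulrAC pow natrM; ring.
have cs (c : K) : smooth W (fun=> c) by exact: (smooth_cst (W := K)).
have ys k : smooth W (fun j => q j ^+ (2 * k) * pro square_time k j) by exact: smoothM.
have Dy k : q j * Dt (fun j => square_coef n k * (q j ^+ (2 * k) * pro square_time k
  j)) j =
    square_coef n k * ((4 * k)%:R * (q j ^+ (2 * k) * pro square_time k j) +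
      q j ^+ (2 * k.+1) * pro square_time k.+1 j).
  rewrite (DtM (cs _) (ys k) Wj) (Dt_cst (square_coef n k)) mul0r addr0.
  rewrite (DtM (qX (2 * k)%N) (ps k) Wj) Dp //.
  transitivity (square_coef n k * (q j * Dt (fun j =>
    q j ^+ (2 * k)) j * pro square_time k j +
    q j ^+ 2 * q j ^+ (2 * k) * pro square_time k.+1 j)); first by ring.
  by rewrite DqX -exprD mulnS mulnA mulrA.
rewrite (Dt_sum (U := W) (F := fun k : 'I_n.+1 => fun j =>
  square_coef n k * (q j ^+ (2 * k) * pro square_time k j))) //; last first.
  by move=> k; exact: smoothM.
move=> /(congr1 (fun z => q j * z)); rewrite mulr_sumr.
under eq_bigr do rewrite Dy.
rewrite [X in q j * X](DtM (qX n) xs Wj) Dt_xder // mulrDr mulrA -exprS mulrA DqX => H.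
rewrite (square_coef_sum n (fun k =>
  q j ^+ (2 * k) * pro square_time k j)) -H -(IH j (ltnW nr) Wj) -/(q j).
by rewrite mulrA addrK.
Qed.

(** Results from dividing the expansion of (2t)^r x^(r) by (2t)^(2r), where (2t)^2 = 4 s; entry [i]
    multiplies x^(i+2). *)
Definition square_target (s : K) : 'rV[K]_(r - 2) :=
  \row_i (square_coef r i.+2 / (4 * s) ^+ (r - i.+2)).

Lemma smooth_square_target : smooth [set s : K | s != 0] square_target.
Proof.
have oI := @open_nonzero_scalars K.
apply: smooth_row => // i.
rewrite (_ : (fun s => _) = fun s : K =>
  square_coef r i.+2 * ((4 * s) ^+ (r - i.+2))^-1); last first.
  by apply/funext => s; rewrite mxE.
apply: smoothM => //; first exact: (smooth_cst (W := K)).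
apply: smoothV => //.
  by move=> s s0; rewrite expf_neq0 // mulf_neq0 // pnatr_eq0.
apply: smoothX => //; apply: smoothM => //; last exact: smooth_id.
exact: (smooth_cst (W := K)).
Qed.

Lemma square_time_maps_equation j : nonzero_time (base j) ->
  arnold2_lhs 0 j = 0 <->
  arnold2_lhs (square_target (time (prolong square_time j))) (prolong square_time j) = 0.
Proof.
move=> Uj; have q0 : 2 * base j 0 0 != 0 by rewrite mulf_neq0 // pnatr_eq0.
rewrite arnold2_lhs_prolong time_prolong row2E0.
have E := jet_expansion (leqnn r) Uj; move: E q0.
set q := 2 * _ => E q0.
have qr0 m : q ^+ m != 0 by rewrite expf_neq0.
have {}E : q ^+ r * xder r j = q ^+ (2 * r) * (pro square_time r j +
    \sum_(i < r - 2) square_target (base j 0 0 ^+ 2) 0 i * pro square_time i.+2 j).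
  rewrite E; have := square_coef_diag r; have := square_coef_above (n := r).
  have rE : r = (r - 2).+2 by rewrite -addn2 subnK // ltnW.
  have -> : \sum_(k < r.+1) square_coef r k * (q ^+ (2 * k) * pro square_time k j) =
      \sum_(0 <= k < r.+1) square_coef r k * (q ^+ (2 * k) * pro square_time k j).
    by rewrite big_mkord.
  (* The term k = r is the leading one, and the terms k = 0 and k = 1 are split off because their
     coefficients vanish for r >= 3. *)
  rewrite big_nat_recr //= (big_ltn (m := 0)) ?(leq_trans _ hr) //.
  rewrite (big_ltn (m := 1)) ?(leq_trans _ hr) //.
  have [n rn] : exists n, r = n.+3 by exists (r - 3)%N; lia.
  have -> : square_coef r 0 = 0 by rewrite rn square_coef0.
  have -> : square_coef r 1 = 0 by rewrite rn square_coef1.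
  rewrite !mul0r !add0r -[X in index_iota X _](add0n 2) big_addn big_mkord => _ ->.
  rewrite mul1r mulrDr addrC; congr (_ + _); rewrite mulr_sumr; apply: eq_bigr => i _.
  have := ltn_ord i; rewrite ltn_subRL add2n => ir.
  have q2 : 4 * base j 0 0 ^+ 2 = q ^+ 2 by rewrite /q; ring.
  rewrite mxE addn2 q2 -exprM.
  have -> : (2 * r = 2 * i.+2 + 2 * (r - i.+2))%N by lia.
  by rewrite exprD; field.
rewrite arnold2_lhs0; split=> [x0|p0]; apply/eqP.
  by move/eqP: E; rewrite x0 mulr0 eq_sym mulf_eq0 (negbTE (qr0 _)).
by move/eqP: E; rewrite p0 mulr0 mulf_eq0 (negbTE (qr0 _)).
Qed.

End SquareTime.

(** * Conclusion *)

Lemma ball_vertically_convex (K : numFieldType) (c : 'rV[K]_2) (e : K) :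
  vertically_convex (ball c e).
Proof.
move=> p q s; rewrite -ball_normE /= => cp cq _ /andP[s0 s1].
have -> : c - (p + s *: (q - p)) = (1 - s) *: (c - p) + s *: (c - q).
  by apply/rowP => i; rewrite !mxE; ring.
apply: le_lt_trans (ler_normD _ _) _; rewrite !normrZ.
have s1' : 0 <= 1 - s by rewrite subr_ge0.
rewrite (ger0_norm s0) (ger0_norm s1').
(* Only the second summand is estimated strictly, which is impossible when s = 0. *)
have [->|sn0] := eqVneq s 0; first by rewrite subr0 mul1r mul0r addr0.
have -> : e = (1 - s) * e + s * e by ring.
apply: ler_ltD; first by apply: ler_wpM2l => //; exact: ltW.
by rewrite ltr_pM2l // lt_neqAle eq_sym sn0.
Qed.

(** * Both classes at once, through [coef], [rhs] and an embedding of coefficient perturbations *)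

Section NotSemiNormalized.
Variables (K : numFieldType) (r m : nat).
Hypothesis hr : (3 <= r)%N.
Hypothesis flatK : flat_constant K.
Variables (L : ode_class K r m) (coef : 'rV[K]_m -> 'rV[K]_(r - 2)) (rhs : 'rV[K]_m -> K).
Variable embed : 'rV[K]_(r - 2) -> 'rV[K]_m.
Hypothesis LE : forall theta j, L theta j = arnold2_lhs (coef theta) j - rhs theta.
Hypothesis coef_embed : forall v a, coef (v + embed a) = coef v + a.
Hypothesis rhs_embed : forall v a, rhs (v + embed a) = rhs v.
Hypothesis coef0 : coef 0 = 0.
Hypothesis rhs0 : rhs 0 = 0.
Hypothesis embedZ : forall d a, embed (d *: a) = d *: embed a.
Hypothesis smooth_embed : forall I (a : K -> 'rV[K]_(r - 2)), open I -> smooth I a ->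
  smooth I (fun s => embed (a s)).

Let L0 theta j : L theta j = 0 <-> arnold2_lhs (coef theta) j = rhs theta.
Proof. by rewrite LE; split=> [/eqP|->]; rewrite ?subrr // subr_eq0 => /eqP. Qed.

Let coefE a : coef (embed a) = a.
Proof. by rewrite -[embed a]add0r coef_embed coef0 add0r. Qed.

Let rhsE a : rhs (embed a) = 0.
Proof. by rewrite -[embed a]add0r rhs_embed. Qed.

Lemma square_time_admissible :
  admissible_transformation L [set: K] (cst 0) [set s | s != 0]
    (fun s => embed (square_target r s)) (nonzero_time (K := K)) (square_time (K := K)).
Proof.
have oI := @open_nonzero_scalars K.
split.
- by split; [exact: openT|exact: smooth_cst].
- by split=> //; apply: smooth_embed => //; exact: smooth_square_target.
- exact: point_transformation_square_time.
- split=> // _ [p p0 <-]; rewrite /strip /= row2E0; exact: expf_neq0.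
- move=> j Uj _; rewrite !L0 coefE rhsE coef0 rhs0.
  exact: square_time_maps_equation.
Qed.

Definition joint (p : 'rV[K]_2) (u : 'rV[K]_r) (v : 'rV[K]_m) : 'rV[K]_(2 + r + m) :=
  row_mx (row_mx p u) v.

Lemma base_joint p u v : base (jet_of (joint p u v)) = p.
Proof. by rewrite /base /jet_of !row_mxKl. Qed.

Lemma elements_joint p u v : elements_of (joint p u v) = v.
Proof. exact: row_mxKr. Qed.

Lemma joint_eta z : z = joint (base (jet_of z)) (rsubmx (jet_of z)) (elements_of z).
Proof. by rewrite /joint !hsubmxK. Qed.

(** Balls of row vectors are products, so the point and the arbitrary elements can be moved
    independently inside [Om]. *)
Lemma ball_joint p u v q w (e : K) : 0 < e -> ball p e q -> ball v e w ->
  ball (joint p u v) e (joint q u w).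
Proof.
move=> e0 [_ pq] [_ vw]; split=> // i j; rewrite /joint.
rewrite -[j]splitK; case: (fintype.split j) => k /=; last by rewrite !row_mxEr.
rewrite !row_mxEl -[k]splitK; case: (fintype.split k) => l /=; first by rewrite !row_mxEl.
by rewrite !row_mxEr; exact: ballxx.
Qed.

Lemma over_constant_graph Om p u v : Om (joint p u v) ->
  joint_proj (over_graph Om setT (cst v)) p.
Proof.
move=> Omz; exists (joint p u v); last exact: base_joint.
by split=> //; exact: elements_joint.
Qed.

(** Through every point of [Om] passes the graph of constant arbitrary elements. [a'] and [b'] are
    chosen before [p], which makes the target coefficients functions of P alone. *)
Lemma constant_equation (Om : set 'rV[K]_(2 + r + m)) Phi phi v :
  equivalence_transformation L Om Phi phi ->
  exists (a' : K -> 'rV[K]_(r - 2)) (b' : K -> K), forall p u, Om (joint p u v) ->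
    forall j : 'rV[K]_(2 + r), base j = p -> prolong_dom phi j ->
      arnold2_lhs (coef v) j = rhs v <->
      arnold2_lhs (a' (phi p 0 0)) (prolong phi j) = b' (phi p 0 0).
Proof.
move=> [_ _ _ /(_ setT (cst v))[]].
  by split; [exact: openT|exact: smooth_cst].
move=> I' [theta' [_ _ maps]].
exists (coef \o theta'), (rhs \o theta') => p u Omz j jp dj.
have := maps j; rewrite jp time_prolong jp !L0; apply => //.
exact: over_constant_graph Omz.
Qed.

Lemma equivalence_projectable Om Phi phi p : equivalence_transformation L Om Phi phi ->
  joint_proj Om p -> dx (fun q => phi q 0 0) p = 0 /\ dt (fun q => phi q 0 0) p != 0 /\
    dx (fun q => phi q 0 1) p != 0.
Proof.
move=> eqv Dp; have [_ [oD _ phis det] _ _] := eqv.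
have jac : dt (fun q => phi q 0 0) p * dx (fun q => phi q 0 1) p -
    dt (fun q => phi q 0 1) p * dx (fun q => phi q 0 0) p != 0.
  by rewrite -det_jacobian2; [exact: det|exact: smooth_differentiable phis Dp].
have Px0 : dx (fun q => phi q 0 0) p = 0.
  have [z Omz zp] := Dp.
  have [a' [b' maps]] := constant_equation (elements_of z) eqv.
  apply: (projectable_time hr oD phis Dp jac (a := coef (elements_of z)) (b := rhs
    (elements_of z))
    (a' := a' (phi p 0 0)) (b' := b' (phi p 0 0))) => j jp tj.
  move=> E; apply/(maps p (rsubmx (jet_of z))) => //.
  by rewrite -zp -joint_eta.
by move: jac; rewrite Px0 mulr0 subr0 mulf_eq0 negb_or => /andP[].
Qed.

Theorem not_semi_normalized : ~ semi_normalized L.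
Proof.
move=> /(_ _ _ _ _ _ _ square_time_admissible)[V0 [sigma [Om [Phi [phi]]]]].
move=> [V0U [_ _ [oV0 [p0 Vp0] sigmas _] _ sym] eqv sV0 factor].
have [[oOm _ _ _] [oD _ phis _] _ _] := eqv.
have [z0 Omz0 z0p] : joint_proj Om (sigma p0) by apply: sV0; exists p0.
pose v0 := elements_of z0; pose u0 := rsubmx (jet_of z0).
have [e e0 eOm] : exists2 e : K, 0 < e & ball z0 e `<=` Om.
  have /nbhs_ballP[e e0 eOm] : nbhs z0 Om by exact: open_nbhs_nbhs.
  by exists e.
have z0E : z0 = joint (sigma p0) u0 v0 by rewrite -z0p /v0 /u0 -joint_eta.
pose w := embed (unit_vector K r).
(* A nonzero perturbation of the coefficient of x'', small enough to remain in [Om]. *)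
have [d d0 dw] : exists2 d : K, d != 0 & ball v0 e (v0 + d *: w).
  have c := @continuous_line K _ w v0 0.
  have near_d : \forall d \near (0 : K), ball v0 e (d *: w + v0).
    by apply: c; rewrite /= scale0r add0r; exact: nbhsx_ballx.
  have : \forall d \near 0^', d != 0 /\ ball v0 e (d *: w + v0).
    by near=> d; split; [near: d; exact: nbhs_dnbhs_neq|near: d;
      exact: cvg_within near_d].
  by move=> /filter_ex[d [d0 dw]]; exists d => //; rewrite addrC.
pose B := ball (sigma p0) e.
have oB : open B by exact: ball_open.
have vB : vertically_convex B by exact: ball_vertically_convex.
have Om1 p : B p -> Om (joint p u0 v0).
  by move=> Bp; apply: eOm; rewrite z0E; apply: ball_joint => //; exact: ballxx.
have Om2 p : B p -> Om (joint p u0 (v0 + d *: w)).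
  by move=> Bp; apply: eOm; rewrite z0E; exact: ball_joint.
have BD p : B p -> joint_proj Om p.
  by move=> Bp; exists (joint p u0 v0); [exact: Om1|exact: base_joint].
have phisB : smooth B phi by apply: smooth_subset phis.
have Px0 p : B p -> dx (fun q => phi q 0 0) p = 0.
  by move=> /BD /(equivalence_projectable eqv)[].
have Pt0 p : B p -> dt (fun q => phi q 0 0) p != 0.
  by move=> /BD /(equivalence_projectable eqv)[_ []].
have Qx0 p : B p -> dx (fun q => phi q 0 1) p != 0.
  by move=> /BD /(equivalence_projectable eqv)[_ []].
have [a1 [b1 maps1]] := constant_equation v0 eqv.
have [a2 [b2 maps2]] := constant_equation (v0 + d *: w) eqv.
(* D_t P = P_t has no zero over [B], so the prolongation is defined at every jet there, whatever x'
   is. *)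
have dom p (j : 'rV[K]_(2 + r)) : B p -> base j = p -> prolong_dom phi j.
  by move=> Bp jp; rewrite /prolong_dom /= (tau_dt hr oB phisB Px0) /= jp //; exact: Pt0.
have i0P : (0 < r - 2)%N by rewrite subn_gt0.
pose i0 := Ordinal i0P.
pose beta s := (b2 s - b1 s) / (a2 s - a1 s) 0 i0.
have lines p y : B p -> 'D_(row2 1 y) (fun q => 'D_(row2 1 y) (fun q => phi q 0 1) q /
    dt (fun q => phi q 0 0) q) p = dt (fun q => phi q 0 0) p * beta (phi p 0 0).
  move=> Bp; rewrite /beta -(@second_derivative_on_lines K r hr B phi oB phisB Px0 Pt0
    (coef v0) (a1 (phi p 0 0)) (a2 (phi p 0 0)) (rhs v0) (b1 (phi p 0 0)) (b2 (phi p 0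
      0)) d p Bp d0 (Qx0 p Bp) _ _ y i0) //.
  - by rewrite mulrC divfK //; exact: Pt0.
  - by move=> j jp; apply: (maps1 p u0 (Om1 p Bp) j jp); exact: dom jp.
  - move=> j jp; have := maps2 p u0 (Om2 p Bp) j jp (dom p j Bp jp).
    by rewrite /w -embedZ coef_embed rhs_embed.
have [Pi ki kk] := lines_to_lines flatK oB vB (smooth_T oB phisB) (smooth_X oB phisB)
  Px0 Pt0 lines.
have [e' e'0 VP] : exists2 e' : K, 0 < e' & forall p, ball p0 e' p -> V0 p /\ B (sigma p).
  have sc : {for p0, continuous sigma}.
    exact: differentiable_continuous (smooth_differentiable sigmas Vp0).
  have : nbhs p0 (V0 `&` sigma @^-1` B).
    apply: filterI; first exact: open_nbhs_nbhs.
    by apply: sc; exact: nbhsx_ballx.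
  by move=> /nbhs_ballP[e' e'0 VB]; exists e'.
pose V := ball p0 e'.
have oV : open V by exact: ball_open.
apply: (@no_factorization K r hr flatK B V phi sigma) => //.
- by apply: (smooth_subset _ sigmas) => p /VP[].
- exact: ball_vertically_convex.
- by exists p0; exact: ballxx.
- by move=> p /VP[/V0U].
- by move=> p /VP[].
- by move=> p /VP[/factor].
- move=> j /VP[Vj _] dj xj.
  by have := sym j Vj dj; rewrite !L0 coef0 rhs0 !arnold2_lhs0 => -[+ _]; apply.
Unshelve. all: by end_near. Qed.

End NotSemiNormalized.

Local Open Scope complex_scope.

Theorem corollary24 (R : realType) (r : nat) (hr : (3 <= r)%N) :
  (~ semi_normalized (@arnold2 R r) /\ ~ semi_normalized (@arnold2_hom R r)) /\
  (~ semi_normalized (@arnold2 R[i] r) /\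
   ~ semi_normalized (@arnold2_hom R[i] r)).
Proof.
have main (K : numFieldType) : flat_constant K ->
    ~ semi_normalized (@arnold2 K r) /\ ~ semi_normalized (@arnold2_hom K r).
  move=> flatK; split.
    apply: (@not_semi_normalized K r _ hr flatK _ lsubmx (fun v =>
      rsubmx v 0 0) (fun a => row_mx a 0)) => //.
    - by move=> v a; rewrite linearD /= row_mxKl.
    - by move=> v a; rewrite linearD /= row_mxKr addr0.
    - by rewrite linear0.
    - by rewrite linear0 mxE.
    - by move=> d a; rewrite scale_row_mx scaler0.
    - move=> I a oI sa; apply: smooth_row => // l.
      rewrite -[l]splitK; case: (fintype.split l) => k /=.
        rewrite (_ : (fun p => _) = fun p => a p 0 k); first exact: smooth_coord.
        by apply/funext => p; rewrite row_mxEl.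
      rewrite (_ : (fun p => _) = cst 0); first exact: smooth_cst.
      by apply/funext => p; rewrite row_mxEr mxE.
  by apply: (@not_semi_normalized K r _ hr flatK _ id (fun=> 0) id) => // theta j;
    rewrite subr0.
by split; apply: main; [exact: real_flat_constant|exact: complex_flat_constant].
Qed.
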